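(* Let $\mu$ be a finite Borel measure on $[0,1)$. Then $\{e^{2\pi i n x}\}_{n=-\infty}^{\infty}$ has a dextrodual sequence in $L^2(\mu)$ (that is, there is a sequence $\{g_n\}_{n=-\infty}^\infty\subseteq L^2(\mu)$ dextrodual to $\{e^{2\pi i n x}\}_{n=-\infty}^{\infty}$ in $L^2(\mu)$) that is a Riesz basis of $L^2(\mu)$ if and only if $\mu$ is absolutely continuous with Radon-Nikodym derivative bounded above and below.
   Context: Measures are positive; absolute continuity and the Radon-Nikodym derivative are with respect to Lebesgue measure. ''Bounded above and below'' means there are constants $0<m\le M<\infty$ with $m\le \frac{d\mu}{dx}\le M$ almost everywhere on $[0,1)$. A sequence $\{g_n\}$ in a Hilbert space $H$ is a frame if there are $A,B>0$ with $A\|f\|^2\le\sum_n|\langle f,g_n\rangle|^2\le B\|f\|^2$ for all $f\in H$. It is a Riesz basis if it is a frame and, for $\{c_n\}\in\ell^2$, $\sum c_ng_n=0$ implies $c_n=0$ for all $n$. A sequence $\{g_n\}$ is dextrodual to a sequence $\{x_n\}$ in $H$ if for all $x\in H$, $x=\sum_n\langle x,g_n\rangle x_n$, with (possibly conditional) convergence in norm; for sequences indexed by $\mathbb Z$ the sum is the limit of the symmetric partial sums $\sum_{n=-M}^{M}$ as $M\to\infty$. *)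

(* Defs.v *)
From HB Require Import structures.
From mathcomp Require Import all_boot all_order all_algebra.
From mathcomp Require Import all_classical all_reals all_analysis.
From mathcomp Require Import complex.

Set Implicit Arguments.
Unset Strict Implicit.
Unset Printing Implicit Defensive.

Import Order.TTheory GRing.Theory Num.Theory.
Import numFieldNormedType.Exports.

Local Open Scope classical_set_scope.
Local Open Scope ring_scope.
Local Open Scope complex_scope.

(* A Hilbert space is presented here by a set [H] of representatives in a
   complex vector space [V] together with an inner product [ip], linear in its
   first argument; vectors whose difference has norm 0 represent the same
   element.  Identities between vectors are therefore always stated through the
   norm. *)
Section frames.
Variables (R : realType) (V : lmodType R[i]) (H : set V) (ip : V -> V -> R[i]).
Implicit Types (f x : V) (g xs : int -> V) (c : int -> R[i]).

Definition ip_norm x : R := Num.sqrt (complex.Re (ip x x)).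

Definition sq_mod (z : R[i]) : R := complex.Re `|z| ^+ 2.

(* k - M runs over the integers -M, ..., M *)
Definition sym_psum xs (M : nat) : V :=
  \sum_(k < M.*2.+1) xs (k%:Z - M%:Z).

Definition sym_sum_to xs x : Prop :=
  ip_norm (x - sym_psum xs M) @[M --> \oo] --> (0 : R).

Definition is_frame g : Prop :=
  (forall n, H (g n)) /\
  exists A B : R, [/\ 0 < A, 0 < B &
    forall f, H f ->
      ((A * ip_norm f ^+ 2)%:E <= \esum_(n in [set: int]) (sq_mod (ip f (g n)))%:E
       /\ \esum_(n in [set: int]) (sq_mod (ip f (g n)))%:E
          <= (B * ip_norm f ^+ 2)%:E)%E].

Definition ell2 : set (int -> R[i]) :=
  [set c | (\esum_(n in [set: int]) (sq_mod (c n))%:E < +oo)%E].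

Definition is_riesz_basis g : Prop :=
  is_frame g /\
  forall c, ell2 c -> sym_sum_to (fun n => c n *: g n) 0 -> forall n, c n = 0.

Definition dextrodual g xs : Prop :=
  [/\ forall n, H (g n), forall n, H (xs n) &
    forall x, H x -> sym_sum_to (fun n => ip x (g n) *: xs n) x].

End frames.

Section L2.
Context d (T : measurableType d) (R : realType).
Variable mu : {measure set T -> \bar R}.

Definition Cintegral (f : T -> R[i]) : R[i] :=
  (\int[mu]_t complex.Re (f t)) +i* (\int[mu]_t complex.Im (f t)).

Definition L2 : set (T -> R[i]) :=
  [set f | [/\ measurable_fun setT (fun t => complex.Re (f t)),
               measurable_fun setT (fun t => complex.Im (f t)) &
               (\int[mu]_t (sq_mod (f t))%:E < +oo)%E]].

Definition L2_ip (f g : T -> R[i]) : R[i] := Cintegral (fun t => f t * (g t)^*).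

End L2.

Definition fourier_exp (R : realType) (n : int) (x : measurableTypeR R) : R[i] :=
  cos (2 * pi * n%:~R * x) +i* sin (2 * pi * n%:~R * x).

(* Main.v *)
Require Import Defs.
From HB Require Import structures.
From mathcomp Require Import all_boot all_order all_algebra.
From mathcomp Require Import all_classical all_reals all_analysis.
From mathcomp Require Import measurable_realfun complex zify ring lra.

(** Write [e n] for the exponentials.  If [g] is a Riesz basis, the analysis
    operator [f |-> (<f, g n>)_n] is onto [ell2]: the minimiser [f] of the distance
    from its values to the [m]-th unit vector leaves a residual [r] with
    [\sum_n r n *: g n = 0], hence [r = 0].  So some [f] satisfies
    [<f, g n> = delta m n], and dextroduality forces [f = e m]; thus
    [<e m, g n> = delta m n].  The frame inequality for a trigonometric polynomial
    [p] with coefficients [c] then reads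
    [A |p|^2 <= \sum_n |c n|^2 = \int_0^1 |p|^2 dx <= B |p|^2] (norms in [L2 mu]),
    and approximating indicator functions by trigonometric polynomials,
    simultaneously for [mu] and Lebesgue measure, gives
    [A mu(S) <= lambda(S) <= B mu(S)] for all Borel sets [S].

    Conversely, if [F = dmu/dx] is bounded above and below, then [g n = e n / F]
    works, because [<x, g n>] in [L2 mu] is the [n]-th Fourier coefficient of [x]. *)

Set Implicit Arguments.
Unset Strict Implicit.
Unset Printing Implicit Defensive.

Import Order.TTheory GRing.Theory Num.Theory.
Import numFieldNormedType.Exports.

Local Open Scope classical_set_scope.
Local Open Scope ring_scope.
Local Open Scope charge_scope.
Local Open Scope complex_scope.

(** * Sums over the integers *)

(** The definition of a Riesz basis supplies no dual system, only the uniqueness of [ell2]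
    expansions of 0; the variational problem is there to produce one. The lower frame bound makes
    the minimisers converge. The normal equation at the minimum is proved in quantitative form,
    [|partial sum|^2 <= 2 B * (tail of the residual)], because the convergence of the series is
    itself part of what the independence hypothesis asks for.

    Vectors are functions rather than classes, so equality of vectors only ever means distance 0,
    and the upper frame bound carries it over to inner products.

    Before the comparison, neither measure is known to dominate the other, so indicators are
    approximated in [L2] of the sum [mu + lambda], where one small energy controls both. Since [mu]
    may a priori have atoms, convergence almost everywhere for Lebesgue measure would not suffice:
    the approximants of a jump must converge at every point of [[0, 1[], the jump and the point 0
    included. *)

Definition int_ball (M : nat) : set int := [set n | (absz n <= M)%N].

Section sum_int.
Variable R : realType.
Implicit Types (a b : int -> R).

Lemma int_ballE (M : nat) :
  int_ball M = (fun k : nat => k%:Z - M%:Z) @` `I_(M.*2.+1).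
Proof.
apply/seteqP; split=> [n|_ [k /= kM <-]]; rewrite /int_ball/=; last by lia.
by move=> nM; exists (absz (n + M%:Z)) => /=; lia.
Qed.

Lemma int_ball_inj (M : nat) : set_inj `I_(M.*2.+1) (fun k : nat => k%:Z - M%:Z).
Proof. by move=> i j _ _ /= ij; lia. Qed.

(* [sym_psum] with values in an arbitrary additive monoid; on vectors the two are
   convertible. *)
Definition psum (V : nmodType) (a : int -> V) (M : nat) : V :=
  \sum_(k < M.*2.+1) a (k%:Z - M%:Z).

Lemma esum_int_ball a (M : nat) : (forall n, 0 <= a n) ->
  (\esum_(n in int_ball M) (a n)%:E = (psum a M)%:E)%E.
Proof.
move=> a0; rewrite int_ballE esum_image; last exact: int_ball_inj.
rewrite esum_fset; [|exact: finite_II|by move=> i _; rewrite lee_fin].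
by rewrite -(fsbig_ord _ _ (fun k : nat => (a (k%:Z - M%:Z))%:E)) /psum sumEFin.
Qed.

Lemma esum_int_split a (M : nat) : (forall n, 0 <= a n) ->
  (\esum_(n in [set: int]) (a n)%:E =
   (psum a M)%:E + \esum_(n in ~` int_ball M) (a n)%:E)%E.
Proof.
move=> a0; rewrite (esumID (int_ball M)); last by move=> *; rewrite lee_fin.
by rewrite !setTI esum_int_ball.
Qed.

Lemma psum_le_esum a (M : nat) : (forall n, 0 <= a n) ->
  ((psum a M)%:E <= \esum_(n in [set: int]) (a n)%:E)%E.
Proof.
move=> a0; rewrite (esum_int_split M)// leeDl// esum_ge0// => n _.
by rewrite lee_fin.
Qed.

Lemma esum_int_fin_support a (M : nat) : (forall n, 0 <= a n) ->
  (forall n, (M < absz n)%N -> a n = 0) ->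
  (\esum_(n in [set: int]) (a n)%:E = (psum a M)%:E)%E.
Proof.
move=> a0 aM; rewrite (esum_int_split M)// esum1 ?adde0// => n.
by rewrite /int_ball/= => /negP; rewrite -ltnNge => /aM ->.
Qed.

(** Every finite set of integers lies in some [int_ball], so the symmetric partial sums are cofinal
    among the finite sums whose supremum is [esum]. *)
Lemma esum_int_le a (C : R) : (forall n, 0 <= a n) ->
  (forall M, psum a M <= C) -> (\esum_(n in [set: int]) (a n)%:E <= C%:E)%E.
Proof.
move=> a0 aC; apply: ge_ereal_sup => _ [F [finF _] <-].
have [M FM] : exists M, F `<=` int_ball M.
  have /finite_seqP[X FX] := finF.
  exists (\sum_(n <- X) absz n)%N => n Fn; rewrite /int_ball/=.
  have nX : n \in X by move: Fn; rewrite FX.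
  by rewrite (big_rem n)//= leq_addr.
apply: (@le_trans _ _ (psum a M)%:E); last by rewrite lee_fin.
rewrite -esum_int_ball// -esum_fset//; last by move=> i _; rewrite lee_fin.
rewrite esum_mkcond [leRHS]esum_mkcond; apply: le_esum => i _.
case: ifPn => [/set_mem/FM/mem_set ->//|_].
by case: ifPn => // _; rewrite lee_fin.
Qed.

Lemma esum_int_tail a (e : R) : (forall n, 0 <= a n) ->
  (\esum_(n in [set: int]) (a n)%:E < +oo)%E -> 0 < e ->
  exists M0, forall M, (M0 <= M)%N ->
    (\esum_(n in ~` int_ball M) (a n)%:E <= e%:E)%E.
Proof.
move=> a0 aoo e0; set S := (\esum_(n in _) _)%E in aoo.
have S0 : (0 <= S)%E by apply: esum_ge0 => n _; rewrite lee_fin.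
have Sfin : S \is a fin_num by rewrite ge0_fin_numE.
have [M0 hM0] : exists M0, (S - e%:E < (psum a M0)%:E)%E.
  apply: contrapT => /forallNP h.
  have : (S <= (fine S - e)%:E)%E.
    by apply: esum_int_le => // M; have /negP := h M; rewrite -leNgt -(fineK Sfin) -EFinB lee_fin.
  by rewrite -{1}(fineK Sfin) lee_fin; lra.
exists M0 => M M0M.
have hM : (S - e%:E <= (psum a M)%:E)%E.
  apply: (le_trans (ltW hM0)); rewrite -!esum_int_ball// esum_mkcond [leRHS]esum_mkcond.
  apply: le_esum => i _; case: ifPn => [/set_mem iM0|_]; last by case: ifPn => // _; rewrite lee_fin.
  by rewrite ifT//; apply/mem_set; exact: leq_trans iM0 M0M.
have := esum_int_split M a0; rewrite -/S => SE.
have tfin : (\esum_(n in ~` int_ball M) (a n)%:E)%E \is a fin_num.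
  rewrite ge0_fin_numE; last by apply: esum_ge0 => n _; rewrite lee_fin.
  by apply: le_lt_trans aoo; rewrite SE leeDr// lee_fin sumr_ge0.
move: hM; rewrite SE -(fineK tfin) -!EFinD !lee_fin; lra.
Qed.

End sum_int.

Lemma psum_delta (V : nmodType) (m : int) (v : V) (M : nat) : (absz m <= M)%N ->
  psum (fun n => if n == m then v else 0) M = v.
Proof.
move=> mM; have h : (absz (m + M%:Z)%R < M.*2.+1)%N by lia.
rewrite /psum (bigD1 (Ordinal h))//= ifT; last by apply/eqP; lia.
rewrite big1 ?addr0// => i /eqP ih; case: eqP => // im; exfalso; apply: ih.
by apply/val_inj => /=; lia.
Qed.

Lemma psum_ext (V : nmodType) (a b : int -> V) (M : nat) :
  (forall n, (absz n <= M)%N -> a n = b n) -> psum a M = psum b M.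
Proof.
move=> ab; apply: eq_bigr => i _; apply: ab; have := ltn_ord i; lia.
Qed.

(** * Pre-Hilbert spaces *)

Section complex_modulus.
Variable R : realType.
Implicit Types z w : R[i].

Lemma sq_modE z : sq_mod z = complex.Re z ^+ 2 + complex.Im z ^+ 2.
Proof. by rewrite /sq_mod normc_def/= sqr_sqrtr// addr_ge0 ?sqr_ge0. Qed.

Lemma sq_mod_ge0 z : 0 <= sq_mod z.
Proof. by rewrite sq_modE addr_ge0 ?sqr_ge0. Qed.

Lemma sq_mod0 : sq_mod (0 : R[i]) = 0.
Proof. by rewrite sq_modE/= expr0n/= addr0. Qed.

Lemma sq_mod_eq0 z : sq_mod z = 0 -> z = 0.
Proof.
rewrite sq_modE => /eqP; rewrite paddr_eq0 ?sqr_ge0// !sqrf_eq0.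
by case: z => a b /= /andP[/eqP-> /eqP->].
Qed.

Lemma sq_modN z : sq_mod (- z) = sq_mod z.
Proof. by case: z => a b; rewrite !sq_modE/= !sqrrN. Qed.

Lemma sq_modM z w : sq_mod (z * w) = sq_mod z * sq_mod w.
Proof. by case: z => a b; case: w => c d; rewrite !sq_modE/=; ring. Qed.

Lemma sq_modB z w :
  sq_mod (z - w) = sq_mod z + sq_mod w - complex.Re (z * w^*) *+ 2.
Proof. by case: z => a b; case: w => c d; rewrite !sq_modE/=; ring. Qed.

Lemma sq_mod_parallelogram z w :
  sq_mod (z + w) + sq_mod (z - w) = sq_mod z *+ 2 + sq_mod w *+ 2.
Proof. by case: z => a b; case: w => c d; rewrite !sq_modE/=; ring. Qed.

Lemma sq_modD_le z w : sq_mod (z + w) <= sq_mod z *+ 2 + sq_mod w *+ 2.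
Proof. by rewrite -sq_mod_parallelogram lerDl sq_mod_ge0. Qed.

Lemma sq_modB_le z w : sq_mod (z - w) <= sq_mod z *+ 2 + sq_mod w *+ 2.
Proof. by rewrite -[sq_mod w]sq_modN sq_modD_le. Qed.

Lemma ReD z w : complex.Re (z + w) = complex.Re z + complex.Re w.
Proof. by case: z => a b; case: w. Qed.

Lemma ImD z w : complex.Im (z + w) = complex.Im z + complex.Im w.
Proof. by case: z => a b; case: w. Qed.

Lemma Re_sum n (F : 'I_n -> R[i]) :
  complex.Re (\sum_(i < n) F i) = \sum_(i < n) complex.Re (F i).
Proof. by apply: (big_morph _ ReD). Qed.

End complex_modulus.

(** The form is only semidefinite, so that square integrable functions fit without a quotient, and
    the laws are restricted to [H], since an integral inner product is linear only where the
    integrals exist. *)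
Definition pre_hilbert (R : realType) (V : lmodType R[i]) (H : set V)
    (ip : V -> V -> R[i]) : Prop :=
  [/\ H 0,
      forall a x y, H x -> H y -> H (a *: x + y),
      forall a x y z, H x -> H y -> H z ->
        ip (a *: x + y) z = a * ip x z + ip y z,
      forall x y, H x -> H y -> ip y x = (ip x y)^* &
      forall x, H x -> 0 <= complex.Re (ip x x)].

Definition sq_norm (R : realType) (V : lmodType R[i]) (ip : V -> V -> R[i]) x : R :=
  complex.Re (ip x x).

Definition ip_complete (R : realType) (V : lmodType R[i]) (H : set V)
    (ip : V -> V -> R[i]) : Prop :=
  forall u : nat -> V, (forall n, H (u n)) ->
  (forall e : R, 0 < e -> exists N, forall m n, (N <= m)%N -> (N <= n)%N ->
     sq_norm ip (u m - u n) < e) ->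
  exists2 x, H x & forall e : R, 0 < e -> exists N, forall n, (N <= n)%N ->
     sq_norm ip (x - u n) < e.

Section pre_hilbert_theory.
Variables (R : realType) (V : lmodType R[i]) (H : set V) (ip : V -> V -> R[i]).
Hypothesis HV : pre_hilbert H ip.
Implicit Types (x y z : V) (a : R[i]) (e g : int -> V) (c : int -> R[i]).
Local Notation N := (sq_norm ip).

Lemma pre_hilbert0 : H 0. Proof. by case: HV. Qed.

Lemma pre_hilbertL a x y : H x -> H y -> H (a *: x + y). Proof. by case: HV => _ h *; exact: h. Qed.

Lemma pre_hilbertD x y : H x -> H y -> H (x + y).
Proof. by move=> Hx Hy; rewrite -[x]scale1r; exact: pre_hilbertL. Qed.

Lemma pre_hilbertZ a x : H x -> H (a *: x).
Proof. by move=> Hx; rewrite -[_ *: _]addr0; apply: pre_hilbertL => //; exact: pre_hilbert0. Qed.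

Lemma pre_hilbertN x : H x -> H (- x).
Proof. by move=> Hx; rewrite -scaleN1r; exact: pre_hilbertZ. Qed.

Lemma pre_hilbertB x y : H x -> H y -> H (x - y).
Proof. by move=> Hx Hy; apply: pre_hilbertD => //; exact: pre_hilbertN. Qed.

Lemma pre_hilbert_psum (f : int -> V) M : (forall n, H (f n)) -> H (psum f M).
Proof. by move=> Hf; rewrite /psum; elim/big_ind : _ => // [|x y]; [exact: pre_hilbert0|exact: pre_hilbertD]. Qed.

Lemma ipDl x y z : H x -> H y -> H z -> ip (x + y) z = ip x z + ip y z.
Proof.
by case: HV => _ _ h _ _ Hx Hy Hz; rewrite -{1}[x]scale1r h// mul1r.
Qed.

Lemma ip0l x : H x -> ip 0 x = 0.
Proof.
move=> Hx; apply: (addIr (ip 0 x)).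
by rewrite add0r -ipDl ?addr0//; exact: pre_hilbert0.
Qed.

Lemma ipZl a x z : H x -> H z -> ip (a *: x) z = a * ip x z.
Proof.
case: HV => h0 _ h _ _ Hx Hz; rewrite -[_ *: _]addr0 h// ip0l ?addr0//.
Qed.

Lemma ipC x y : H x -> H y -> ip y x = (ip x y)^*.
Proof. by case: HV => _ _ _ h _ *; exact: h. Qed.

Lemma ipNl x z : H x -> H z -> ip (- x) z = - ip x z.
Proof. by move=> Hx Hz; rewrite -scaleN1r ipZl// mulN1r. Qed.

Lemma ipBl x y z : H x -> H y -> H z -> ip (x - y) z = ip x z - ip y z.
Proof. by move=> Hx Hy Hz; rewrite ipDl ?ipNl//; exact: pre_hilbertN. Qed.

Lemma ip_psuml (f : int -> V) M z : (forall n, H (f n)) -> H z ->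
  ip (psum f M) z = psum (fun n => ip (f n) z) M.
Proof.
move=> Hf Hz; rewrite /psum.
have : forall s : seq 'I_(M.*2.+1), let v := \sum_(k <- s) f (k%:Z - M%:Z) in
    H v /\ ip v z = \sum_(k <- s) ip (f (k%:Z - M%:Z)) z.
  elim=> [|k s [Hs IH]]/=; first by rewrite !big_nil ip0l//; split => //; exact: pre_hilbert0.
  by rewrite !big_cons; split; [exact: pre_hilbertD|rewrite ipDl// IH].
by move=> /(_ (index_enum _))[].
Qed.

Lemma sq_norm_ge0 x : H x -> 0 <= N x. Proof. by case: HV => _ _ _ _ h /h. Qed.

Lemma ip_norm_sqr x : H x -> ip_norm ip x ^+ 2 = N x.
Proof. by move=> Hx; rewrite /ip_norm sqr_sqrtr//; exact: sq_norm_ge0. Qed.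

Lemma ip_xx x : H x -> ip x x = (N x)%:C.
Proof.
move=> Hx; have := ipC Hx Hx; rewrite /sq_norm; case: (ip x x) => a b [] /= h.
by congr (_ +i* _); lra.
Qed.

Lemma sq_normD x y : H x -> H y -> N (x + y) = N x + N y + complex.Re (ip x y) *+ 2.
Proof.
move=> Hx Hy; have Hxy := pre_hilbertD Hx Hy.
rewrite /sq_norm ipDl// (ipC Hxy Hx) (ipC Hxy Hy) !ipDl// (ipC Hx Hy).
by case: (ip x x) => a b; case: (ip y y) => c d; case: (ip x y) => p q /=; ring.
Qed.

Lemma sq_normZ a x : H x -> N (a *: x) = sq_mod a * N x.
Proof.
move=> Hx; rewrite /sq_norm ipZl ?(ipC (pre_hilbertZ a Hx) Hx) ?ipZl ?ip_xx//; last exact: pre_hilbertZ.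
by rewrite sq_modE; case: a => a b /=; rewrite !(mulr0,subr0,mul0r,addr0,add0r); ring.
Qed.

Lemma sq_normN x : H x -> N (- x) = N x.
Proof. by move=> Hx; rewrite -scaleN1r sq_normZ// sq_modN sq_modE/= expr1n expr0n/= addr0 mul1r. Qed.

Lemma sq_normB x y : H x -> H y -> N (x - y) = N x + N y - complex.Re (ip x y) *+ 2.
Proof.
move=> Hx Hy; have HNy := pre_hilbertN Hy; rewrite sq_normD// sq_normN// (ipC HNy Hx) ipNl// (ipC Hx Hy).
by case: (ip x y) => a b /=; rewrite mulNrn.
Qed.

Lemma cauchy_schwarz x y : H x -> H y -> sq_mod (ip x y) <= N x * N y.
Proof.
move=> Hx Hy; have Nx := sq_norm_ge0 Hx; have Ny := sq_norm_ge0 Hy.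
(* This is the squared norm of [x - t <x, y> y], with [t] real. *)
have h (t : R) : 0 <= N x + t ^+ 2 * sq_mod (ip x y) * N y - t * sq_mod (ip x y) *+ 2.
  have Ht := pre_hilbertZ (t%:C * ip x y) Hy.
  have := sq_norm_ge0 (pre_hilbertB Hx Ht); rewrite sq_normB// sq_normZ// sq_modM.
  rewrite (ipC Ht Hx) ipZl// (ipC Hx Hy) !sq_modE/=.
  by case: (ip x y) => p q/=; congr (0 <= _); ring.
have p0 := sq_mod_ge0 (ip x y).
have [Ny0|Ny0] := eqVneq (N y) 0.
  rewrite Ny0 mulr0; set p := sq_mod _ in h p0 *.
  (* A nonzero [y] may have norm 0. The bound [h] is then affine in [t], and this [t] would turn its
     right-hand side into [- N x - 2]. *)
  rewrite leNgt; apply/negP => pgt; have := h ((N x + 1) / p).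
  rewrite Ny0 mulr0 addr0 -mulrA mulVf ?gt_eqF// mulr1; lra.
have {}Ny : 0 < N y by rewrite lt_def Ny0.
have := h (N y)^-1; set p := sq_mod _ in p0 *; rewrite -(ler_pM2r Ny) mul0r.
by rewrite [X in _ <= X -> _](_ : _ = N x * N y - p) ?subr_ge0//; field; rewrite gt_eqF.
Qed.

End pre_hilbert_theory.

(** * Riesz bases *)

Section square_sums.
Variable R : realType.
Implicit Types (c d : int -> R[i]).

Definition sqsum c : \bar R := \esum_(n in [set: int]) (sq_mod (c n))%:E.

Lemma sqsum_ge0 c : (0 <= sqsum c)%E.
Proof. by apply: esum_ge0 => n _; rewrite lee_fin sq_mod_ge0. Qed.

Lemma sqsum_fineK c : ell2 c -> sqsum c = (fine (sqsum c))%:E.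
Proof. by move=> c2; rewrite fineK// ge0_fin_numE// sqsum_ge0. Qed.

Lemma sqsum_parallelogram c d :
  (sqsum (fun n => c n + d n)%R + sqsum (fun n => c n - d n)%R =
   sqsum c + sqsum c + (sqsum d + sqsum d))%E.
Proof.
rewrite /sqsum -!esumD; [|by move=> n _; rewrite -?EFinD lee_fin ?addr_ge0 ?sq_mod_ge0 ..].
by apply: eq_esum => n _; rewrite -!EFinD sq_mod_parallelogram !mulr2n.
Qed.

Lemma ell2B c d : ell2 c -> ell2 d -> ell2 (fun n => c n - d n).
Proof.
move=> c2 d2; rewrite /ell2/=.
apply: (@le_lt_trans _ _ (sqsum c + sqsum c + (sqsum d + sqsum d))%E).
  by rewrite -sqsum_parallelogram leeDr// sqsum_ge0.
by rewrite !lte_add_pinfty.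
Qed.

Lemma ell2_delta (m : int) : ell2 (fun n => (n == m)%:R : R[i]).
Proof.
rewrite /ell2/= (esum_int_fin_support (M := absz m)) ?ltry// => n; first exact: sq_mod_ge0.
by case: eqP => [->|_]; rewrite ?ltnn// sq_mod0.
Qed.

Lemma sq_mod_le_sqsum c n : ((sq_mod (c n))%:E <= sqsum c)%E.
Proof.
apply: esum_ge; exists [set n]; last by rewrite fsbig_set1.
by split => //; exact: finite_set1.
Qed.

End square_sums.

Section symmetric_sums.
Variables (R : realType) (V : lmodType R[i]) (H : set V) (ip : V -> V -> R[i]).
Hypothesis HV : pre_hilbert H ip.
Implicit Types (x : V) (u : int -> V).
Local Notation N := (sq_norm ip).

Lemma sym_sum_toP u x : (forall n, H (u n)) -> H x ->
  sym_sum_to ip u x <->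
  (forall e, 0 < e -> exists M0, forall M, (M0 <= M)%N -> N (x - psum u M) <= e).
Proof.
move=> Hu Hx; have Hs M : H (x - psum u M) by apply: (pre_hilbertB HV) => //; exact: (pre_hilbert_psum HV).
rewrite /sym_sum_to; split=> [/cvgrPdist_le h e e0|h].
  have [|M0 _ hM] := h (Num.sqrt e); first by rewrite sqrtr_gt0.
  exists M0 => M /hM/=; rewrite sub0r normrN ger0_norm ?sqrtr_ge0// => le.
  rewrite -(ip_norm_sqr HV)// -[leRHS]sqr_sqrtr ?(ltW e0)//.
  by rewrite ler_sqr ?nnegrE ?sqrtr_ge0.
apply/cvgrPdist_le => /= e e0; have [|M0 hM] := h (e ^+ 2); first by rewrite exprn_gt0.
exists M0 => // M /= /hM le; rewrite sub0r normrN ger0_norm ?sqrtr_ge0//.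
rewrite -ler_sqr ?nnegrE ?sqrtr_ge0 ?(ltW e0)//.
by rewrite (ip_norm_sqr HV (Hs M)).
Qed.

End symmetric_sums.

Section riesz.
Variables (R : realType) (V : lmodType R[i]) (H : set V) (ip : V -> V -> R[i]).
Hypothesis HV : pre_hilbert H ip.
Hypothesis Hcomplete : ip_complete H ip.
Local Notation N := (sq_norm ip).
Variables (g : int -> V) (A B : R).
Hypothesis Hg : forall n, H (g n).
Hypothesis A0 : 0 < A.
Hypothesis B0 : 0 < B.
Hypothesis frame_lb : forall f, H f -> ((A * N f)%:E <= sqsum (fun n => ip f (g n)))%E.
Hypothesis frame_ub : forall f, H f -> (sqsum (fun n => ip f (g n)) <= (B * N f)%:E)%E.

Let ell2_ip f : H f -> ell2 (fun n => ip f (g n)).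
Proof. by move=> /frame_ub h; apply: (le_lt_trans h); rewrite ltry. Qed.

(** In [ell2], [Q f] is the squared norm of the analysis coefficients of [f], and [J m f] their
    squared distance to the [m]-th unit vector. The upper frame bound makes both sums finite on [H],
    so [fine] loses nothing there. *)
Let Q f : R := fine (sqsum (fun n => ip f (g n))).
Let r m f (n : int) : R[i] := (n == m)%:R - ip f (g n).
Let J m f : R := fine (sqsum (r m f)).

Let QE f : H f -> sqsum (fun n => ip f (g n)) = (Q f)%:E.
Proof. by move=> /ell2_ip/sqsum_fineK. Qed.

Let ell2_r m f : H f -> ell2 (r m f).
Proof. by move=> Hf; apply: ell2B; [exact: ell2_delta|exact: ell2_ip]. Qed.

Let JE m f : H f -> sqsum (r m f) = (J m f)%:E.
Proof. by move=> Hf; exact/sqsum_fineK/ell2_r. Qed.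

Let J_ge0 m f : 0 <= J m f. Proof. by apply: fine_ge0; exact: sqsum_ge0. Qed.

(** The residual [r m] is affine in [f], its linear part being minus the analysis operator; this is
    the parallelogram law of [ell2]. *)
Let J_parallelogram m x h : H x -> H h ->
  J m (x - h) + J m (x + h) = J m x *+ 2 + Q h *+ 2.
Proof.
move=> Hx Hh; have Hp := pre_hilbertD HV Hx Hh; have Hm := pre_hilbertB HV Hx Hh.
have := sqsum_parallelogram (r m x) (fun n => ip h (g n)).
rewrite (_ : (fun n => r m x n + _) = r m (x - h)); last first.
  by apply/funext => n; rewrite /r (ipBl HV)//; ring.
rewrite (_ : (fun n => r m x n - _) = r m (x + h)); last first.
  by apply/funext => n; rewrite /r (ipDl HV)//; ring.
by rewrite !JE// QE// -!EFinD => -[->]; rewrite !mulr2n.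
Qed.

(* Completeness is used here: by the parallelogram law a minimising sequence has
   Cauchy images, so it is itself Cauchy by the lower frame bound. *)
Let minimizer m : exists2 f, H f & forall h, H h -> J m f <= J m h.
Proof.
pose I := inf [set J m f | f in H].
have lbI : has_lbound [set J m f | f in H] by exists 0 => _ [f _ <-].
have hI : has_inf [set J m f | f in H].
  by split => //; exists (J m 0), 0 => //; exact: (pre_hilbert0 HV).
have IJ f : H f -> I <= J m f by move=> Hf; apply: ge_inf => //; exists f.
have approx (k : nat) : {f | H f /\ J m f < I + k.+1%:R^-1}.
  apply/cid; have [|_ [f Hf <-] lt] := @inf_adherent _ _ (k.+1%:R^-1) _ hI.
    by rewrite invr_gt0.
  by exists f.
pose f_ k := sval (approx k).
have Hf k : H (f_ k) by case: (svalP (approx k)).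
have Jf k : J m (f_ k) < I + k.+1%:R^-1 by case: (svalP (approx k)).
have small (e : R) : 0 < e -> exists K : nat, forall k, (K <= k)%N -> k.+1%:R^-1 < e.
  move=> e0; have := near_infty_natSinv_lt (PosNum e0) => -[K _ hK].
  by exists K => k /hK.
have QA x : H x -> A * N x <= Q x.
  by move=> Hx; rewrite -lee_fin -QE//; exact: frame_lb.
have QB x : H x -> Q x <= B * N x.
  by move=> Hx; rewrite -lee_fin -QE//; exact: frame_ub.
have [|f0 Hf0 cvf] := Hcomplete Hf.
  move=> e e0; have [|K hK] := small (A * e / 4); first by rewrite divr_gt0 ?mulr_gt0.
  exists K => k l Kk Kl; have Hkl := pre_hilbertB HV (Hf k) (Hf l).
  (* The point [f_ l + h] is the midpoint of [f_ k] and [f_ l], where [J] is at least [I]. Hence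
     [2 Q h] is at most the sum of the two excesses over [I], while [Q h >= A N(f_ k - f_ l) / 4];
     this fixes the threshold [A e / 4]. *)
  pose h := (2^-1 : R[i]) *: (f_ k - f_ l).
  have Hh : H h by exact: (pre_hilbertZ HV).
  have Hx : H (f_ l + h) by exact: (pre_hilbertD HV).
  have := J_parallelogram m Hx Hh.
  rewrite addrK -addrA -scalerDl -mulr2n -[2^-1 *+ 2]mulr_natl divff ?pnatr_eq0//.
  rewrite scale1r addrC subrK => para.
  have := QA _ Hh; rewrite /h (sq_normZ HV)// -/h => Qh.
  have s2 : sq_mod (2^-1 : R[i]) = 4^-1.
    have -> : (2^-1 : R[i]) = (2^-1)%:C by rewrite rmorphV ?unitfE ?pnatr_eq0// rmorph_nat.
    by rewrite sq_modE/=; field.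
  rewrite s2 in Qh.
  rewrite -[N (_ - _) < e](ltr_pM2l A0).
  move: (hK _ Kk) (hK _ Kl) (Jf k) (Jf l) (IJ _ Hx) para Qh.
  move: (k.+1%:R^-1) (l.+1%:R^-1) (N (f_ k - f_ l)) => x y n; lra.
exists f0 => // h Hh; apply: le_trans (IJ _ Hh).
apply/ler_addgt0Pr => e e0.
have [|K1 hK1] := small (e / 4); first by rewrite divr_gt0.
have [|K2 hK2] := cvf (e / (4 * B)); first by rewrite divr_gt0 ?mulr_gt0.
(* The parallelogram law at [f_ k] with step [y] compares [f0] with its reflection [f_ k - y], where
   [J] is at least [I]. So [J m f0 <= 2 J m (f_ k) - I + 2 Q y], and the last term is at most
   [e / 2] by the upper frame bound. *)
pose k := maxn K1 K2; pose y := f0 - f_ k.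
have Hy : H y by exact: (pre_hilbertB HV).
have := J_parallelogram m (Hf k) Hy; rewrite /y addrC [f_ k + _]addrC subrK -/y.
have := IJ _ (pre_hilbertB HV (Hf k) Hy); have := Jf k; have := hK1 k (leq_maxl _ _).
have := QB _ Hy; have := hK2 k (leq_maxr _ _); rewrite -/y.
rewrite ltr_pdivlMr ?mulr_gt0//.
move: (k.+1%:R^-1) (N y) => x n; lra.
Qed.

(* Compare [J] at the minimiser with its value after a step of length [1 / (2 B)] along
   the partial sum. *)
Let residual_bound m f M : H f -> (forall h, H h -> J m f <= J m h) ->
  ((N (psum (fun n => r m f n *: g n) M))%:E <=
   (2 * B)%:E * \esum_(n in ~` int_ball M) (sq_mod (r m f n))%:E)%E.
Proof.
move=> Hf Jmin; set rf := r m f; set s := psum _ M.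
have Hrg n : H (rf n *: g n) by exact: (pre_hilbertZ HV).
have Hs : H s by exact: (pre_hilbert_psum HV).
pose c : R := (2 * B)^-1; have c0 : 0 < c by rewrite invr_gt0 mulr_gt0.
pose w (n : int) := ip (c%:C *: s) (g n).
have Hcs : H (c%:C *: s) by exact: (pre_hilbertZ HV).
set t := (\esum_(n in ~` _) _)%E.
have t0 : (0 <= t)%E by apply: esum_ge0 => n _; rewrite lee_fin sq_mod_ge0.
have tfin : t \is a fin_num.
  rewrite ge0_fin_numE//; apply: le_lt_trans (ell2_r m Hf).
  by rewrite (esum_int_split M) ?leeDr// ?lee_fin ?sumr_ge0// => n *; exact: sq_mod_ge0.
have wE : (sqsum w <= (B * (c ^+ 2 * N s))%:E)%E.
  apply: (le_trans (frame_ub Hcs)); rewrite lee_fin (sq_normZ HV)// sq_modE/=.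
  by rewrite [0 ^+ 2]expr0n addr0.
have wfin : ell2 w by exact: ell2_ip.
(* Since [w] consists of the coefficients of [c s], the cross terms over the ball assemble into
   [c <s, s>]: this is the derivative of [J] in the direction [s]. *)
have crossE : psum (fun n => complex.Re (rf n * (w n)^*)) M = c * N s.
  rewrite [RHS](_ : _ = complex.Re (c%:C * ip s s)); last first.
    by rewrite /sq_norm; case: (ip s s) => a b /=; rewrite mul0r subr0.
  rewrite {1}/s (ip_psuml HV)// /psum mulr_sumr Re_sum; apply: eq_bigr => k _.
  rewrite /w (ipZl HV)// (ipZl HV)// (ipC HV (Hg _) Hs).
  by case: (ip (g _) s) => a b; case: (rf _) => p q /=; ring.
(* Inside the ball the square is expanded exactly. Outside it is bounded by [2 |r|^2 + 2 |w|^2],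
   which costs one extra tail [t] and at most one extra [sqsum w]. *)
have main : (sqsum (r m (f + c%:C *: s)) <=
    sqsum rf + t + (sqsum w + sqsum w) - (c * N s *+ 2)%:E)%E.
  have -> : r m (f + c%:C *: s) = (fun n => rf n - w n).
    by apply/funext => n; rewrite /rf /r (ipDl HV)// /w; ring.
  rewrite [leLHS](@esum_int_split _ _ M); last by move=> n; exact: sq_mod_ge0.
  rewrite /sqsum [X in (X + t + _)%E](@esum_int_split _ _ M); last first.
    by move=> n; exact: sq_mod_ge0.
  rewrite ![\esum_(n in [set: int]) (sq_mod (w n))%:E](@esum_int_split _ _ M); last first.
    by move=> n; exact: sq_mod_ge0.
  rewrite -/t; set tw := (\esum_(n in _) (sq_mod (w n))%:E)%E.
  have tw0 : (0 <= tw)%E by apply: esum_ge0 => n _; rewrite lee_fin sq_mod_ge0.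
  have twfin : tw \is a fin_num.
    rewrite ge0_fin_numE//; apply: le_lt_trans wfin.
    by rewrite (esum_int_split M) ?leeDr// ?lee_fin ?sumr_ge0// => n *; exact: sq_mod_ge0.
  set tr := (\esum_(n in _) (sq_mod (_ - _))%:E)%E.
  have trle : (tr <= t + t + (tw + tw))%E.
    rewrite -!esumD; [|by move=> n _; rewrite -?EFinD lee_fin ?addr_ge0 ?sq_mod_ge0 ..].
    by apply: le_esum => n _; rewrite -!EFinD lee_fin -!mulr2n sq_modB_le.
  have -> : psum (fun n => sq_mod (rf n - w n)) M =
      psum (fun n => sq_mod (rf n)) M + psum (fun n => sq_mod (w n)) M - c * N s *+ 2.
    rewrite -crossE /psum -sumrMnl -big_split -sumrB/=.
    by apply: eq_bigr => k _; rewrite sq_modB.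
  have trfin : tr \is a fin_num.
    rewrite ge0_fin_numE; last by apply: esum_ge0 => n _; rewrite lee_fin sq_mod_ge0.
    by apply: (le_lt_trans trle); rewrite -(fineK tfin) -(fineK twfin) -!EFinD ltry.
  have pw0 : 0 <= psum (fun n => sq_mod (w n)) M by apply: sumr_ge0 => *; exact: sq_mod_ge0.
  move: trle; rewrite -(fineK tfin) -(fineK twfin) -(fineK trfin) -!EFinD !lee_fin.
  lra.
move: main; rewrite JE ?JE//; last exact: (pre_hilbertD HV).
have := Jmin _ (pre_hilbertD HV Hf Hcs).
move: wE; rewrite (sqsum_fineK wfin) -(fineK tfin) -EFinM -!EFinD !lee_fin.
(* Minimality leaves [2 c N s <= t + 2 B c^2 N s]. The choice [c = 1 / (2 B)] makes the quadratic
   term equal to [c N s], half of the left-hand side. *)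
have cB : B * c *+ 2 = 1 by rewrite /c; field; rewrite gt_eqF.
move=> wE J1 J2.
have : N s * c *+ 2 <= fine t + B * (c ^+ 2 * N s) *+ 2 by lra.
have -> : B * (c ^+ 2 * N s) *+ 2 = (B * c *+ 2) * (N s * c) by ring.
rewrite cB mul1r => h.
have {}h : N s * c <= fine t by lra.
have -> : N s = (2 * B) * (N s * c) by rewrite /c; field; rewrite gt_eqF.
by rewrite ler_pM2l// mulr_gt0.
Qed.

(** By [residual_bound], summability of the residual makes its synthesis converge to 0; independence
    then annihilates the residual. *)
Lemma riesz_dual_vector m :
  (forall c, ell2 c -> sym_sum_to ip (fun n => c n *: g n) 0 -> forall n, c n = 0) ->
  exists2 f, H f & forall n, ip f (g n) = (n == m)%:R.
Proof.
move=> indep; have [f Hf Jmin] := minimizer m; exists f => // n.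
have Hrg n' : H (r m f n' *: g n') by exact: (pre_hilbertZ HV).
suff : r m f n = 0 by move=> /eqP; rewrite subr_eq0 eq_sym => /eqP.
apply: indep; first exact: ell2_r.
apply/(sym_sum_toP HV) => //; first exact: (pre_hilbert0 HV).
move=> e e0.
have [|M0 hM] := @esum_int_tail _ _ (e / (2 * B)) (fun n => sq_mod_ge0 (r m f n)) (ell2_r m Hf).
  by rewrite divr_gt0 ?mulr_gt0.
exists M0 => M /hM tM; rewrite sub0r (sq_normN HV); last exact: (pre_hilbert_psum HV).
rewrite -lee_fin; apply: (le_trans (residual_bound M Hf Jmin)).
apply: (@le_trans _ _ ((2 * B)%:E * (e / (2 * B))%:E)%E).
  by apply: lee_wpmul2l => //; rewrite lee_fin ltW// mulr_gt0.
by rewrite -EFinM lee_fin mulrC divfK// gt_eqF// mulr_gt0.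
Qed.

End riesz.

(** * Biorthogonality from dextroduality *)

Section hilbert.
Variables (R : realType) (V : lmodType R[i]) (H : set V) (ip : V -> V -> R[i]).
Hypothesis HV : pre_hilbert H ip.
Local Notation N := (sq_norm ip).
Implicit Types (g e u : int -> V) (x : V).

Lemma is_frame_sqsum g : is_frame H ip g -> (forall n, H (g n)) /\
  exists A B : R, [/\ 0 < A, 0 < B,
    forall f, H f -> ((A * N f)%:E <= sqsum (fun n => ip f (g n)))%E &
    forall f, H f -> (sqsum (fun n => ip f (g n)) <= (B * N f)%:E)%E].
Proof.
move=> [Hg [A [B [A0 B0 hAB]]]]; split=> //; exists A, B; split => // f Hf;
  by have [] := hAB f Hf; rewrite (ip_norm_sqr HV).
Qed.

Lemma riesz_dextrodual_biorthogonal g e : ip_complete H ip ->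
  dextrodual H ip g e -> is_riesz_basis H ip g ->
  forall m n, ip (e m) (g n) = (n == m)%:R.
Proof.
move=> Hc [_ He dual] [/is_frame_sqsum[Hg [A [B [A0 B0 lb ub]]]] indep] m n.
have [f Hf fg] := riesz_dual_vector HV Hc Hg A0 B0 lb ub m indep.
have Hu k : H (ip f (g k) *: e k) by exact: (pre_hilbertZ HV).
have Hd : H (f - e m) by exact: (pre_hilbertB HV).
(* The coefficients of [f] are those of a unit vector, so every partial sum of its dextrodual
   expansion of order at least [|m|] is [e m] itself. *)
have Nle eps : 0 < eps -> N (f - e m) <= eps.
  move=> eps0; have /(sym_sum_toP HV Hu Hf)/(_ _ eps0)[M0 hM] := dual f Hf.
  have := hM (maxn M0 (absz m)) (leq_maxl _ _).
  rewrite (@psum_ext _ _ (fun k => if k == m then e m else 0)); last first.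
    by move=> k _; rewrite fg; case: eqP => [->|_]; rewrite ?scale1r ?scale0r.
  by rewrite psum_delta// leq_maxr.
have N0 : N (f - e m) <= 0 by apply/ler_addgt0Pr => eps /Nle; rewrite add0r.
(* Distance 0 does not identify [f] with [e m] as vectors; the upper frame bound shows that they
   have the same inner products with each [g n]. *)
have := le_trans (sq_mod_le_sqsum (fun k => ip (f - e m) (g k)) n) (ub _ Hd).
rewrite lee_fin => le; have {}le : sq_mod (ip (f - e m) (g n)) <= 0.
  by apply: (le_trans le); rewrite pmulr_rle0.
have /sq_mod_eq0 : sq_mod (ip (f - e m) (g n)) = 0.
  by apply/eqP; rewrite eq_le le sq_mod_ge0.
by rewrite (ipBl HV)// fg => /eqP; rewrite subr_eq0 eq_sym => /eqP.
Qed.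

Lemma sqsum_biorthogonal_psum g e (c : int -> R[i]) M :
  (forall n, H (g n)) -> (forall n, H (e n)) ->
  (forall m n, ip (e m) (g n) = (n == m)%:R) ->
  sqsum (fun n => ip (psum (fun k => c k *: e k) M) (g n)) =
  (psum (fun k => sq_mod (c k)) M)%:E.
Proof.
move=> Hg He eg.
have ipE n : ip (psum (fun k => c k *: e k) M) (g n) = psum (fun k => if k == n then c n else 0) M.
  rewrite (ip_psuml HV)//; last by move=> k; exact: (pre_hilbertZ HV).
  apply: psum_ext => k _; rewrite (ipZl HV)// eg eq_sym.
  by case: eqP => [->|_]; rewrite ?mulr1 ?mulr0.
rewrite /sqsum (@esum_int_fin_support _ _ M) => [|n|n nM]; last 2 first.
- exact: sq_mod_ge0.
- rewrite ipE (@psum_ext _ _ (fun=> 0)) ?/psum ?big1 ?sq_mod0// => k kM.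
  by case: eqP => // kn; move: nM; rewrite -kn ltnNge kM.
by congr (_%:E); apply: psum_ext => n nM; rewrite ipE psum_delta.
Qed.

End hilbert.

(** * Orthonormal systems: best approximation and Parseval's identity *)

Section orthonormal.
Variables (R : realType) (V : lmodType R[i]) (H : set V) (ip : V -> V -> R[i]).
Hypothesis HV : pre_hilbert H ip.
Local Notation N := (sq_norm ip).
Variable e : int -> V.
Hypothesis He : forall n, H (e n).
Hypothesis orth : forall m n, ip (e m) (e n) = (n == m)%:R.

Let Hce (c : int -> R[i]) n : H (c n *: e n). Proof. exact: (pre_hilbertZ HV). Qed.
Let Hs (c : int -> R[i]) M : H (psum (fun n => c n *: e n) M).
Proof. exact/(pre_hilbert_psum HV)/Hce. Qed.

Lemma ip_orthonormal_psum c M x : H x ->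
  ip (psum (fun n => c n *: e n) M) x = psum (fun n => c n * (ip x (e n))^*) M.
Proof.
move=> Hx; rewrite (ip_psuml HV)//.
by apply: psum_ext => n _; rewrite (ipZl HV)// (ipC HV Hx).
Qed.

Lemma sq_norm_orthonormal_psum c M :
  N (psum (fun n => c n *: e n) M) = psum (fun n => sq_mod (c n)) M.
Proof.
rewrite /sq_norm ip_orthonormal_psum// Re_sum; apply: eq_bigr => k _.
have kM : (absz (k%:Z - M%:Z) <= M)%N by have := ltn_ord k; lia.
rewrite (ip_psuml HV)//.
rewrite (@psum_ext _ _ (fun n => if n == k%:Z - M%:Z then c n else 0)); last first.
  by move=> n _; rewrite (ipZl HV)// orth eq_sym; case: eqP; rewrite ?mulr1 ?mulr0.
rewrite (@psum_ext _ _ (fun n => if n == k%:Z - M%:Z then c (k%:Z - M%:Z) else 0)).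
  by rewrite psum_delta// sq_modE; case: (c _) => a b /=; ring.
by move=> n _; case: eqP => // ->.
Qed.

(** Completing the square in each coefficient. The last sum vanishes exactly at the Fourier
    coefficients, so these approximate at least as well as the [c] supplied by [total]. *)
Lemma sq_norm_sub_orthonormal_psum x c M : H x ->
  N (x - psum (fun n => c n *: e n) M) =
  N x - psum (fun n => sq_mod (ip x (e n))) M + psum (fun n => sq_mod (c n - ip x (e n))) M.
Proof.
move=> Hx; rewrite (sq_normB HV)// sq_norm_orthonormal_psum (ipC HV (Hs _ _) Hx).
rewrite ip_orthonormal_psum// -!addrA; congr (_ + _).
have -> z : complex.Re z^* = complex.Re z :> R by case: z.
rewrite Re_sum /psum -sumrMnl -!sumrB -sumrN -big_split/=; apply: eq_bigr => k _.
by rewrite sq_modB; ring.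
Qed.

Hypothesis total : forall x eps, H x -> 0 < eps ->
  exists c M0, forall M, (M0 <= M)%N -> N (x - psum (fun n => c n *: e n) M) < eps.

Lemma fourier_partial_sum x eps : H x -> 0 < eps -> exists M0, forall M, (M0 <= M)%N ->
  N x - psum (fun n => sq_mod (ip x (e n))) M < eps.
Proof.
move=> Hx eps0; have [c [M0 hM]] := total Hx eps0; exists M0 => M /hM.
rewrite sq_norm_sub_orthonormal_psum//; apply: le_lt_trans.
by rewrite lerDl sumr_ge0// => k _; exact: sq_mod_ge0.
Qed.

Lemma fourier_expansion x : H x -> sym_sum_to ip (fun n => ip x (e n) *: e n) x.
Proof.
move=> Hx; apply/(sym_sum_toP HV) => //; first exact: Hce.
move=> eps eps0; have [M0 hM] := fourier_partial_sum Hx eps0.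
exists M0 => M /hM/ltW; rewrite sq_norm_sub_orthonormal_psum//.
rewrite [X in _ -> _ + X <= _](_ : _ = 0) ?addr0//.
by rewrite /psum big1// => k _; rewrite subrr sq_mod0.
Qed.

Lemma parseval x : H x -> sqsum (fun n => ip x (e n)) = (N x)%:E.
Proof.
move=> Hx; have s0 n : 0 <= sq_mod (ip x (e n)) by exact: sq_mod_ge0.
apply/eqP; rewrite eq_le; apply/andP; split.
  apply: esum_int_le => // M.
  have := sq_norm_ge0 HV (pre_hilbertB HV Hx (Hs (fun n => ip x (e n)) M)).
  rewrite sq_norm_sub_orthonormal_psum// [X in _ <= _ + X](_ : _ = 0) ?addr0 ?subr_ge0//.
  by rewrite /psum big1// => k _; rewrite subrr sq_mod0.
apply/lee_addgt0Pr => eps eps0; have [M0 hM] := fourier_partial_sum Hx eps0.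
apply: (@le_trans _ _ ((psum (fun n => sq_mod (ip x (e n))) M0)%:E + eps%:E)%E).
  by have := hM _ (leqnn _); rewrite -EFinD lee_fin; lra.
by rewrite leeD2r//; exact: psum_le_esum.
Qed.

End orthonormal.

(** * The space L2 *)

Section L2_theory.
Context d (T : measurableType d) (R : realType).
Implicit Types (f g x y z : T -> R[i]) (a : R[i]).

Definition cmeasurable f : Prop :=
  measurable_fun setT (fun t => complex.Re (f t)) /\
  measurable_fun setT (fun t => complex.Im (f t)).

Lemma cmeasurable_cst a : cmeasurable (fun=> a).
Proof. by split; exact: measurable_cst. Qed.

Lemma cmeasurableD f g : cmeasurable f -> cmeasurable g -> cmeasurable (fun t => f t + g t).
Proof.
move=> [mf1 mf2] [mg1 mg2]; split.
  by under eq_fun do rewrite ReD; exact: measurable_funD.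
by under eq_fun do rewrite ImD; exact: measurable_funD.
Qed.

Lemma cmeasurableM f g : cmeasurable f -> cmeasurable g -> cmeasurable (fun t => f t * g t).
Proof.
move=> [mf1 mf2] [mg1 mg2]; split.
  rewrite (_ : (fun _ => _) = (fun t => complex.Re (f t) * complex.Re (g t) -
      complex.Im (f t) * complex.Im (g t))); last first.
    by apply/funext => t; case: (f t) => p q; case: (g t).
  by apply: measurable_funB; exact: measurable_funM.
rewrite (_ : (fun _ => _) = (fun t => complex.Re (f t) * complex.Im (g t) +
    complex.Im (f t) * complex.Re (g t))); last first.
  by apply/funext => t; case: (f t) => p q; case: (g t).
by apply: measurable_funD; exact: measurable_funM.
Qed.

Lemma cmeasurable_conj f : cmeasurable f -> cmeasurable (fun t => (f t)^*).
Proof.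
move=> [m1 m2]; split.
  by rewrite (_ : (fun _ => _) = (fun t => complex.Re (f t)))//; apply/funext => t; case: (f t).
rewrite (_ : (fun _ => _) = (fun t => - complex.Im (f t))); first exact: measurable_funN.
by apply/funext => t; case: (f t).
Qed.

Lemma cmeasurable_real (h : T -> R) : measurable_fun setT h -> cmeasurable (fun t => (h t)%:C).
Proof. by move=> mh; split => //=; exact: measurable_cst. Qed.

Lemma cmeasurableB f g : cmeasurable f -> cmeasurable g -> cmeasurable (fun t => f t - g t).
Proof.
move=> mf mg; rewrite (_ : (fun _ => _) = (fun t => f t + (-1) * g t)).
  by apply: cmeasurableD => //; apply: cmeasurableM => //; exact: cmeasurable_cst.
by apply/funext => t; rewrite mulN1r.
Qed.

Lemma measurable_sq_mod f : cmeasurable f -> measurable_fun setT (fun t => sq_mod (f t)).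
Proof.
move=> [m1 m2]; under eq_fun do rewrite sq_modE.
by apply: measurable_funD; exact: measurable_funX.
Qed.

Lemma emeasurable_sq_mod f : cmeasurable f -> measurable_fun setT (fun t => (sq_mod (f t))%:E).
Proof. by move=> mf; apply/measurable_EFinP/measurable_sq_mod. Qed.

Variable mu : {measure set T -> \bar R}.

Definition energy f : \bar R := (\int[mu]_t (sq_mod (f t))%:E)%E.

Lemma energy_ge0 f : (0 <= energy f)%E.
Proof. by apply: integral_ge0 => t _; rewrite lee_fin sq_mod_ge0. Qed.

Lemma energyD_le f g : cmeasurable f -> cmeasurable g ->
  (energy (fun t => f t + g t)%R <= energy f + energy f + (energy g + energy g))%E.
Proof.
move=> mf mg; have e0 h t : [set: T] t -> (0 <= (sq_mod (h t : R[i]))%:E)%E.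
  by rewrite lee_fin sq_mod_ge0.
rewrite /energy -!ge0_integralD//; try exact: emeasurable_sq_mod; try exact: e0;
  try (by move=> t _; rewrite -EFinD lee_fin addr_ge0 ?sq_mod_ge0);
  try (by apply: emeasurable_funD; exact: emeasurable_sq_mod).
apply: ge0_le_integral => //; first exact: e0.
- exact/emeasurable_sq_mod/cmeasurableD.
- by do 2?apply: emeasurable_funD; exact: emeasurable_sq_mod.
- by move=> t _; rewrite -!EFinD lee_fin -!mulr2n sq_modD_le.
Qed.

Lemma energyZ a f : cmeasurable f ->
  energy (fun t => a * f t) = ((sq_mod a)%:E * energy f)%E.
Proof.
move=> mf; rewrite /energy; under eq_integral do rewrite sq_modM EFinM.
rewrite ge0_integralZl_EFin ?sq_mod_ge0//; last exact: emeasurable_sq_mod.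
by move=> t _; rewrite lee_fin sq_mod_ge0.
Qed.

Lemma L2P f : L2 mu f <-> cmeasurable f /\ (energy f < +oo)%E.
Proof. by split=> [[? ? ?]|[[? ?] ?]]; split. Qed.

Lemma L2_cmeasurable f : L2 mu f -> cmeasurable f.
Proof. by case/L2P. Qed.

Lemma L2_energy f : L2 mu f -> energy f = (fine (energy f))%:E.
Proof. by case/L2P => _ foo; rewrite fineK// ge0_fin_numE// energy_ge0. Qed.

Lemma L2D f g : L2 mu f -> L2 mu g -> L2 mu (fun t => f t + g t).
Proof.
move=> /L2P[mf fi] /L2P[mg gi]; apply/L2P; split; first exact: cmeasurableD.
apply: (le_lt_trans (energyD_le mf mg)).
exact: (lte_add_pinfty (lte_add_pinfty fi fi) (lte_add_pinfty gi gi)).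
Qed.

Lemma L2Z a f : L2 mu f -> L2 mu (fun t => a * f t).
Proof.
move=> Lf; have [mf _] := (L2P f).1 Lf; apply/L2P; split.
  by apply: cmeasurableM => //; exact: cmeasurable_cst.
by rewrite energyZ// (L2_energy Lf) -EFinM ltry.
Qed.

Lemma L2_0 : L2 mu 0.
Proof.
apply/L2P; split; first exact: (cmeasurable_cst 0).
by rewrite /energy; under eq_integral do rewrite sq_mod0; rewrite integral0.
Qed.

Let Re_le x y t : `|complex.Re (x t * (y t)^*)| <= sq_mod (x t) + sq_mod (y t).
Proof.
rewrite ler_norml; case: (x t) => p q; case: (y t) => u v; rewrite !sq_modE/=.
have := sqr_ge0 (p + u); have := sqr_ge0 (p - u); have := sqr_ge0 (q + v).
have := sqr_ge0 (q - v); have := sqr_ge0 p; have := sqr_ge0 q.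
by have := sqr_ge0 u; have := sqr_ge0 v; nra.
Qed.

Lemma L2_integrable_Re x y : L2 mu x -> L2 mu y ->
  mu.-integrable setT (EFin \o (fun t => complex.Re (x t * (y t)^*))).
Proof.
move=> Lx Ly; have mx := L2_cmeasurable Lx; have my := L2_cmeasurable Ly.
have [mxy _] := cmeasurableM mx (cmeasurable_conj my).
have ix z : L2 mu z -> mu.-integrable setT (fun t => (sq_mod (z t))%:E).
  move=> /L2P[mz zoo]; apply/integrableP; split; first exact: emeasurable_sq_mod.
  by under eq_integral do rewrite gee0_abs ?lee_fin ?sq_mod_ge0//.
apply: le_integrable (integrableD measurableT (ix _ Lx) (ix _ Ly)) => //.
  exact/measurable_EFinP.
by move=> t _ /=; rewrite lee_fin; apply: (le_trans (Re_le x y t)); exact: ler_norm.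
Qed.

Lemma L2_integrable_Im x y : L2 mu x -> L2 mu y ->
  mu.-integrable setT (EFin \o (fun t => complex.Im (x t * (y t)^*))).
Proof.
(* The imaginary part of [x y^*] is the real part of [x (i y)^*]. *)
move=> Lx Ly; have := L2_integrable_Re Lx (L2Z ('i%C : R[i]) Ly).
congr (integrable _ _ (_ \o _)); apply/funext => t.
by case: (x t) => p q; case: (y t) => u v /=; ring.
Qed.

Lemma L2_ip_sq_norm x : sq_norm (L2_ip mu) x = fine (energy x).
Proof.
rewrite /sq_norm /= /Rintegral /energy; congr fine; apply: eq_integral => t _.
by congr (_%:E); rewrite sq_modE; case: (x t) => p q /=; ring.
Qed.

Lemma L2_sq_normE x : L2 mu x -> (sq_norm (L2_ip mu) x)%:E = energy x.
Proof. by move=> Lx; rewrite L2_ip_sq_norm -L2_energy. Qed.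

Lemma L2_pre_hilbert : pre_hilbert (L2 mu) (L2_ip mu).
Proof.
split=> [|a x y Lx Ly|a x y z Lx Ly Lz|x y Lx Ly|x Lx].
- exact: L2_0.
- by apply: L2D => //; exact: L2Z.
- have iR := L2_integrable_Re Lx Lz; have iI := L2_integrable_Im Lx Lz.
  have iR' := L2_integrable_Re Ly Lz; have iI' := L2_integrable_Im Ly Lz.
  have iZ (k : R) (h : T -> R) : mu.-integrable setT (EFin \o h) ->
      mu.-integrable setT (EFin \o (fun t => k * h t)).
    by move=> ih; apply: (integrableZl measurableT k ih).
  rewrite /L2_ip /Cintegral [RHS]complexE; apply/eqP.
  rewrite eq_complex; apply/andP; split; apply/eqP => /=.
    transitivity (\int[mu]_t ((complex.Re a * complex.Re (x t * (z t)^*) +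
        (- complex.Im a) * complex.Im (x t * (z t)^*)) + complex.Re (y t * (z t)^*))).
      apply: eq_Rintegral => t _; rewrite !fctE.
      by case: a => p q; case: (x t) => u v; case: (y t) => u' v'; case: (z t) => w w' /=; ring.
    rewrite RintegralD//; last first.
      by have := integrableD measurableT (iZ (complex.Re a) _ iR) (iZ (- complex.Im a) _ iI).
    rewrite RintegralD//; [|exact: iZ..].
    by rewrite !RintegralZl//; case: a => p q /=; ring.
  transitivity (\int[mu]_t ((complex.Re a * complex.Im (x t * (z t)^*) +
      complex.Im a * complex.Re (x t * (z t)^*)) + complex.Im (y t * (z t)^*))).
    apply: eq_Rintegral => t _; rewrite !fctE.
    by case: a => p q; case: (x t) => u v; case: (y t) => u' v'; case: (z t) => w w' /=; ring.
  rewrite RintegralD//; last first.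
    by have := integrableD measurableT (iZ (complex.Re a) _ iI) (iZ (complex.Im a) _ iR).
  rewrite RintegralD//; [|exact: iZ..].
  by rewrite !RintegralZl//; case: a => p q /=; ring.
- rewrite /L2_ip /Cintegral; congr (_ +i* _).
    apply: eq_Rintegral => t _.
    by case: (x t) => u v; case: (y t) => u' v' /=; ring.
  rewrite -mulN1r -RintegralZl//; last exact: L2_integrable_Im.
  apply: eq_Rintegral => t _.
  by case: (x t) => u v; case: (y t) => u' v' /=; ring.
- by rewrite -/(sq_norm _ _) L2_ip_sq_norm fine_ge0// energy_ge0.
Qed.

End L2_theory.

(** * Completeness of L2 (Riesz-Fischer) *)

Section real_sequences.
Variable R : realType.

Lemma cvg_geometric_increments (a : R^nat) (C : R) :
  (forall k, `|a k.+1 - a k| <= C * 2^-1 ^+ k) -> cvgn a.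
Proof.
move=> ha; have -> : a = (fun n => a 0%N + series (telescope a) n).
  by apply/funext => n; exact: eq_sum_telescope.
apply: is_cvgD; first exact: is_cvg_cst.
apply: normed_cvg; apply: (@series_le_cvg _ _ (geometric C 2^-1)) => //.
- by move=> k; exact: normr_ge0.
- by move=> k; exact: le_trans (normr_ge0 _) (ha k).
- by apply: is_cvg_geometric_series; rewrite ger0_norm// invf_lt1// ltr1n.
Qed.

End real_sequences.

Section L2_complete.
Context d (T : measurableType d) (R : realType).
Variable mu : {measure set T -> \bar R}.

(** Lower semicontinuity of the energy under pointwise limits. It turns a Cauchy estimate between
    members of a sequence into an estimate for the limit. *)
Lemma energy_fatou (v : nat -> T -> R[i]) (f : T -> R[i]) (e : R) :
  (forall k, cmeasurable (v k)) ->
  (forall t, (fun k => complex.Re (v k t)) @ \oo --> complex.Re (f t)) ->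
  (forall t, (fun k => complex.Im (v k t)) @ \oo --> complex.Im (f t)) ->
  (forall k, (energy mu (v k) <= e%:E)%E) -> (energy mu f <= e%:E)%E.
Proof.
move=> mv cR cI ve; pose F k t := (sq_mod (v k t))%:E.
have cF t : F ^~ t @ \oo --> (sq_mod (f t))%:E.
  apply: cvg_EFin; first by apply: nearW.
  rewrite sq_modE (_ : _ \o _ = (fun k => complex.Re (v k t) ^+ 2 + complex.Im (v k t) ^+ 2)).
    by apply: cvgD; rewrite !expr2; apply: cvgM; [exact: cR|exact: cR|exact: cI|exact: cI].
  by apply/funext => k /=; rewrite sq_modE.
have mF k : measurable_fun setT (F k) by exact: emeasurable_sq_mod.
have F0 k t : [set: T] t -> (0 <= F k t)%E by rewrite lee_fin sq_mod_ge0.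
have -> : energy mu f = (\int[mu]_t limn_einf (F ^~ t))%E.
  by apply: eq_integral => t _; rewrite (cvg_limn_einf_sup (cF t)).1.
apply: (le_trans (fatou mu measurableT mF F0)).
rewrite limn_einf_lim; apply: lime_le; first exact: is_cvg_einfs.
apply: nearW => n; apply: (le_trans _ (ve n)).
by apply: ereal_inf_lbound; exists n => /=.
Qed.

End L2_complete.

Section L2_complete.
Context d (T : measurableType d) (R : realType).
Variable mu : {measure set T -> \bar R}.

Lemma L2_complete : ip_complete (L2 mu) (L2_ip mu).
Proof.
move=> u Lu cauchy.
have HV := L2_pre_hilbert mu.
have mu_ n : cmeasurable (u n) by exact: (L2_cmeasurable (Lu n)).
have cE (e : R) : 0 < e -> exists N, forall m n, (N <= m)%N -> (N <= n)%N ->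
    (energy mu (fun t => u m t - u n t)%R <= e%:E)%E.
  move=> e0; have [N hN] := cauchy e e0; exists N => m n Nm Nn.
  by rewrite -(L2_sq_normE (pre_hilbertB HV (Lu m) (Lu n))) lee_fin ltW// hN.
(* The factor [4^-1 ^+ k] cancels the weight used below, and the remaining [2 / 2 ^ k.+1] sum to
   2. *)
pose e_ k : R := 2 / (2 ^ k.+1)%:R * 4^-1 ^+ k.
have e_gt0 k : 0 < e_ k.
  by rewrite /e_ mulr_gt0 ?exprn_gt0 ?invr_gt0// divr_gt0// ltr0n expn_gt0.
have [N_ hN_] := choice (fun k => cE _ (e_gt0 k)).
(* Accumulating the thresholds puts both [n_ k] and [n_ k.+1] beyond [N_ k]; the summand [k] makes
   the indices tend to infinity. *)
pose n_ k := (k + \sum_(j < k.+1) N_ j)%N.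
have n_ge k : (k <= n_ k)%N by exact: leq_addr.
have nN k : (N_ k <= n_ k)%N by rewrite /n_ big_ord_recr/=; lia.
have nN1 k : (N_ k <= n_ k.+1)%N by rewrite /n_ 2!big_ord_recr/=; lia.
pose w k := u (n_ k); pose dw k t := w k.+1 t - w k t.
have mw k : cmeasurable (w k) by exact: mu_.
have mdw k : cmeasurable (dw k) by exact: cmeasurableB (mw _) (mw _).
(* The weights [4 ^+ k] make [G t < +oo] imply that the increments [dw k t] decrease
   geometrically, while [G] stays integrable. *)
pose h k t : \bar R := (4 ^+ k * sq_mod (dw k t))%:E.
have p4 k : 0 <= 4 ^+ k :> R by rewrite exprn_ge0// ler0n.
have h0 k t : (0 <= h k t)%E by rewrite lee_fin mulr_ge0 ?p4 ?sq_mod_ge0.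
have mh k : measurable_fun setT (h k).
  by apply/measurable_EFinP/measurable_funM => //; exact: measurable_sq_mod.
pose G t : \bar R := (\sum_(k <oo) h k t)%E.
have mG : measurable_fun setT G by apply: ge0_emeasurable_sum => // k t _ _; exact: h0.
have G0 t : (0 <= G t)%E by apply: nneseries_ge0.
have Gfin : (\int[mu]_t G t < +oo)%E.
  rewrite /G integral_nneseries//.
  apply: (@le_lt_trans _ _ 2%:E); last exact: ltry.
  apply: le_trans (epsilon_trick0 xpredT (_ : 0 <= 2 :> R)) => //.
  apply: lee_nneseries => [k _ _|k _]; first exact: integral_ge0.
  rewrite /h; under eq_integral do rewrite EFinM.
  rewrite ge0_integralZl_EFin ?p4//; last 2 first.
  - by move=> t _; rewrite lee_fin sq_mod_ge0.
  - exact: emeasurable_sq_mod.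
  apply: (@le_trans _ _ ((4 ^+ k)%:E * (e_ k)%:E)%E).
    by apply: lee_wpmul2l; [rewrite lee_fin p4|exact: hN_].
  rewrite -EFinM lee_fin /e_ mulrCA -exprMn divff ?pnatr_eq0//.
  by rewrite expr1n mulr1.
have iG : mu.-integrable setT G.
  apply/integrableP; split => //.
  by under eq_integral do rewrite gee0_abs//.
pose D := [set t | G t \is a fin_num].
have mD : measurable D by have := emeasurable_fin_num measurableT mG; rewrite setTI.
(* Cutting off outside [D], whose complement is null because [G] is integrable, makes the sequence
   converge at every point without changing energies. *)
pose v k t := (\1_D t : R)%:C * w k t.
have mv k : cmeasurable (v k).
  by apply: cmeasurableM => //; apply: cmeasurable_real; exact: measurable_indic.
have cvv t : exists C : R, forall k,
    `|complex.Re (v k.+1 t) - complex.Re (v k t)| <= C * 2^-1 ^+ k /\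
    `|complex.Im (v k.+1 t) - complex.Im (v k t)| <= C * 2^-1 ^+ k.
  have [tD|tD] := boolP (t \in D); last first.
    exists 0 => k; rewrite /v indicE (negbTE tD) !mul0r !subrr normr0; split => //.
  have Gt : G t = (fine (G t))%:E by rewrite fineK//; move/set_mem: tD.
  have g0 : 0 <= fine (G t) by exact: fine_ge0.
  (* From [4 ^+ k * |dw k t|^2 <= G t <= (1 + G t)^2]; the constant [1 + G t] stands in for the
     square root of [G t]. *)
  exists (1 + fine (G t)) => k; rewrite /v indicE tD !mul1r.
  have hk : sq_mod (dw k t) <= ((1 + fine (G t)) * 2^-1 ^+ k) ^+ 2.
    have : (h k t <= G t)%E.
      rewrite /G (nneseries_split 0 k.+1)// add0n big_nat_recr//= -addeA.
      apply: lee_paddl; first exact: sume_ge0.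
      by rewrite leeDl// nneseries_ge0.
    rewrite [X in (_ <= X)%E -> _]Gt lee_fin exprMn -exprM mulnC exprM => hk.
    have -> : 2^-1 ^+ 2 = 4^-1 :> R by field.
    rewrite exprVn ler_pdivlMr ?exprn_gt0// mulrC; apply: (le_trans hk).
    have := sqr_ge0 (fine (G t)); move: (fine (G t)) g0 => g g0 g2. lra.
  have C0 : 0 <= (1 + fine (G t)) * 2^-1 ^+ k by rewrite mulr_ge0 ?exprn_ge0 ?addr_ge0.
  have s (z z' : R[i]) : complex.Re z - complex.Re z' = complex.Re (z - z') /\
     complex.Im z - complex.Im z' = complex.Im (z - z') by case: z => a b; case: z'.
  rewrite (s (w k.+1 t) (w k t)).1 (s (w k.+1 t) (w k t)).2.
  by split; rewrite -ler_sqr ?nnegrE// real_normK ?num_real//;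
    apply: le_trans hk; rewrite sq_modE ?lerDl ?lerDr sqr_ge0.
pose f t := limn (fun k => complex.Re (v k t)) +i* limn (fun k => complex.Im (v k t)).
have cR t : (fun k => complex.Re (v k t)) @ \oo --> complex.Re (f t).
  by have [C hC] := cvv t; apply: (@cvg_geometric_increments _ _ C) => k; have [] := hC k.
have cI t : (fun k => complex.Im (v k t)) @ \oo --> complex.Im (f t).
  by have [C hC] := cvv t; apply: (@cvg_geometric_increments _ _ C) => k; have [] := hC k.
have mf : cmeasurable f.
  split; [apply: (@measurable_fun_cvg _ _ _ _ (fun k t => complex.Re (v k t)))
         |apply: (@measurable_fun_cvg _ _ _ _ (fun k t => complex.Im (v k t)))] => //.
  - by move=> k; case: (mv k).
  - by move=> k; case: (mv k).
have energy_v k n : energy mu (fun t => v k t - u n t)%R = energy mu (fun t => w k t - u n t)%R.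
  apply: ge0_ae_eq_integral => //; try by (move=> t _; rewrite lee_fin sq_mod_ge0).
  - exact/emeasurable_sq_mod/cmeasurableB.
  - exact/emeasurable_sq_mod/cmeasurableB.
  have := integrable_ae measurableT iG; apply: filterS => t /(_ I) tD _.
  by rewrite /v indicE mem_set// mul1r.
have lim (e : R) : 0 < e -> exists N, forall n, (N <= n)%N ->
    (energy mu (fun t => f t - u n t)%R <= e%:E)%E.
  move=> e0; have [N hN] := cE e e0; exists N => n Nn.
  (* The shift by [N] keeps every index [n_ (k + N)] beyond [N], so the Cauchy bound holds for all
     [k]. *)
  apply: (@energy_fatou _ _ _ _ (fun k t => v (k + N)%N t - u n t)).
  - by move=> k; exact: cmeasurableB.
  - move=> t; rewrite [X in _ --> X](_ : _ = complex.Re (f t) - complex.Re (u n t)).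
      rewrite (_ : (fun _ => _) = (fun k => complex.Re (v (k + N)%N t) - complex.Re (u n t))).
        apply: cvgB; last exact: cvg_cst.
        by have := cR t; rewrite -(cvg_shiftn N).
      by apply/funext => k; case: (v _ _) => a b; case: (u n t).
    by case: (f t) => a b; case: (u n t).
  - move=> t; rewrite [X in _ --> X](_ : _ = complex.Im (f t) - complex.Im (u n t)).
      rewrite (_ : (fun _ => _) = (fun k => complex.Im (v (k + N)%N t) - complex.Im (u n t))).
        apply: cvgB; last exact: cvg_cst.
        by have := cI t; rewrite -(cvg_shiftn N).
      by apply/funext => k; case: (v _ _) => a b; case: (u n t).
    by case: (f t) => a b; case: (u n t).
  - move=> k; rewrite energy_v; apply: hN => //.
    exact: leq_trans (leq_addl k N) (n_ge _).
have Ldiff n (e : R) : (energy mu (fun t => f t - u n t)%R <= e%:E)%E -> L2 mu (f - u n).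
  by move=> le; apply/L2P; split; [exact: cmeasurableB|exact: (le_lt_trans le (ltry _))].
exists f.
  have [N hN] := lim 1 ltr01; have := L2D (Ldiff _ _ (hN _ (leqnn _))) (Lu N).
  by congr (L2 mu _); apply/funext => t; rewrite !fctE subrK.
move=> e e0; have [|N hN] := lim (e / 2); first by rewrite divr_gt0.
exists N => n /hN le; have Lfn := Ldiff _ _ le.
by move: le; rewrite -(L2_sq_normE Lfn) lee_fin; lra.
Qed.

End L2_complete.

(** * Density of trigonometric polynomials *)

Section trigonometric_polynomials.
Variable R : realType.
Local Notation T := (measurableTypeR R).
Local Notation e := (@fourier_exp R).
Implicit Types (f g : T -> R[i]) (a : R[i]).

Lemma fourier_expD m n t : e (m + n) t = e m t * e n t.
Proof.
rewrite /fourier_exp; have -> : 2 * pi * (m + n)%:~R * t = 2 * pi * m%:~R * t + 2 * pi * n%:~R * t.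
  by rewrite intrD; ring.
by rewrite cosD sinD; apply/eqP; rewrite eq_complex/=; apply/andP; split; apply/eqP; ring.
Qed.

Lemma fourier_exp0 t : e 0 t = 1.
Proof. by rewrite /fourier_exp mulr0 mul0r cos0 sin0. Qed.

Lemma fourier_expN n t : e (- n) t = (e n t)^*.
Proof. by rewrite /fourier_exp rmorphN/= mulrN mulNr cosN sinN. Qed.

Lemma sq_mod_fourier_exp n t : sq_mod (e n t) = 1.
Proof. by rewrite sq_modE/= cos2Dsin2. Qed.

Lemma cmeasurable_fourier_exp n : cmeasurable (e n).
Proof.
have ml : measurable_fun setT (fun t : T => 2 * pi * n%:~R * t : R).
  exact: measurable_funM.
split; apply: (measurableT_comp _ ml); apply: continuous_measurable_fun.
- exact: continuous_cos.
- exact: continuous_sin.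
Qed.

(** A predicate on functions instead of a coefficient sequence: closure under sums, products and
    powers, needed to compose with ordinary polynomials, is then a plain induction. Coefficients are
    recovered in [trigpoly_psum]. *)
Inductive trigpoly : (T -> R[i]) -> Prop :=
| TrigPoly0 : trigpoly (fun=> 0)
| TrigPolyS n a f : trigpoly f -> trigpoly (fun t => a * e n t + f t).

Lemma trigpolyD f g : trigpoly f -> trigpoly g -> trigpoly (fun t => f t + g t).
Proof.
move=> tf tg; elim: tf => [|n a h _ IH]; first by under eq_fun do rewrite add0r.
by under eq_fun do rewrite -addrA; exact: TrigPolyS.
Qed.

Lemma trigpolyM f g : trigpoly f -> trigpoly g -> trigpoly (fun t => f t * g t).
Proof.
move=> tf tg; elim: tf => [|n a h _ IH].
  by under eq_fun do rewrite mul0r; exact: TrigPoly0.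
under eq_fun do rewrite mulrDl; apply: trigpolyD => //.
elim: tg => [|m b k _ IHk]; first by under eq_fun do rewrite mulr0; exact: TrigPoly0.
rewrite (_ : (fun _ => _) = (fun t => (a * b) * e (n + m) t + a * e n t * k t)).
  exact: TrigPolyS.
by apply/funext => t; rewrite fourier_expD; ring.
Qed.

Lemma trigpoly_exp a n : trigpoly (fun t => a * e n t).
Proof. by have := TrigPolyS n a TrigPoly0; under eq_fun do rewrite addr0. Qed.

Lemma trigpoly_cst a : trigpoly (fun=> a).
Proof. by have := trigpoly_exp a 0; under eq_fun do rewrite fourier_exp0 mulr1. Qed.

Lemma trigpolyX f k : trigpoly f -> trigpoly (fun t => f t ^+ k).
Proof.
move=> tf; elim: k => [|k IH]; first by under eq_fun do rewrite expr0; exact: trigpoly_cst.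
by under eq_fun do rewrite exprS; exact: trigpolyM.
Qed.

Lemma trigpolyB f g : trigpoly f -> trigpoly g -> trigpoly (fun t => f t - g t).
Proof.
move=> tf tg; under eq_fun do rewrite -mulN1r.
by apply: trigpolyD => //; apply: trigpolyM => //; exact: trigpoly_cst.
Qed.

Lemma cmeasurable_trigpoly f : trigpoly f -> cmeasurable f.
Proof.
elim=> [|n a h _ IH]; first exact: cmeasurable_cst.
apply: cmeasurableD => //; apply: cmeasurableM; first exact: cmeasurable_cst.
exact: cmeasurable_fourier_exp.
Qed.

Lemma trigpoly_psum f : trigpoly f -> exists c M0, forall M, (M0 <= M)%N ->
  f = psum (fun n => c n *: e n) M.
Proof.
elim=> [|n a h _ [c [M0 hM]]].
  exists (fun=> 0), 0%N => M _; rewrite /psum big1// => k _; exact: scale0r.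
exists (fun k => (if k == n then a else 0) + c k), (maxn M0 (absz n)) => M.
rewrite geq_max => /andP[/hM hE nM].
have -> : psum (fun k => ((if k == n then a else 0) + c k) *: e k) M =
    psum (fun k => if k == n then a *: e n else 0) M + psum (fun k => c k *: e k) M.
  rewrite /psum -big_split; apply: eq_bigr => k _; rewrite scalerDl.
  by case: eqP => [->//|_]; rewrite scale0r.
by rewrite psum_delta// -hE.
Qed.

End trigonometric_polynomials.

(** * Polynomials converging pointwise to a step function *)

Section step_approximation.
Variable R : realType.
Implicit Types (s y : R).

Lemma bernoulli_inequality y n : -1 <= y -> 1 + n%:R * y <= (1 + y) ^+ n.
Proof.
move=> y1; elim: n => [|n IH]; first by rewrite mul0r addr0 expr0.
rewrite exprS; have : (1 + y) * (1 + n%:R * y) <= (1 + y) * (1 + y) ^+ n.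
  by rewrite ler_wpM2l//; lra.
apply: le_trans; rewrite -natr1; have : 0 <= n%:R * y ^+ 2 by rewrite mulr_ge0 ?sqr_ge0.
by move: (n%:R) => m; nra.
Qed.

Lemma cvg_natmul_expr s : 0 <= s < 1 -> (fun k => k%:R * s ^+ k) @ \oo --> 0.
Proof.
(* Splitting [s ^+ k] as [r ^+ k * r ^+ k]: one factor absorbs [k], because [k r^k <= 1 + r + ... +
   r^(k-1) <= 1 / (1 - r)], and the other tends to 0. *)
move=> /andP[s0 s1]; pose r := Num.sqrt s.
have r0 : 0 <= r by exact: sqrtr_ge0.
have r1 : r < 1 by rewrite -[ltRHS]sqrtr1 ltr_sqrt.
have bound k : k%:R * r ^+ k * (1 - r) <= 1 - r ^+ k.
  elim: k => [|k IH]; first by rewrite !mul0r subrr.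
  rewrite exprS -natr1; have := exprn_ge0 k r0; have := exprn_ile1 k r0 (ltW r1).
  have : r * (k%:R * r ^+ k * (1 - r)) <= r * (1 - r ^+ k) by rewrite ler_wpM2l.
  move: (k%:R) (r ^+ k) => m p h p1 p0.
  have : r * p * (1 - r) <= 1 - r by rewrite ler_piMl ?subr_ge0 ?(ltW r1)// mulr_ile1// ltW.
  nra.
apply: (@squeeze_cvgr _ _ _ _ (fun=> 0) (fun k => (1 - r)^-1 * r ^+ k)).
- apply: nearW => k; rewrite mulr_ge0 ?exprn_ge0//= -(sqr_sqrtr s0) -/r -exprM mulnC exprM expr2 mulrA.
  rewrite ler_wpM2r ?exprn_ge0// -[leRHS]mul1r ler_pdivlMr ?subr_gt0//.
  by apply: (le_trans (bound k)); rewrite gerBl exprn_ge0.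
- exact: cvg_cst.
- rewrite -[X in _ --> X](mulr0 (1 - r)^-1); apply: cvgMl_tmp.
  by apply: cvg_expr; rewrite ger0_norm.
Qed.

(* The exponent [k * 2 ^ k] makes the limit the indicator of [s < 1/2] at every point of
   [[0, 1]], including [1/2]. *)
Definition step_poly (k : nat) s : R := (1 - s ^+ k) ^+ (k * 2 ^ k).

Lemma step_poly_itv k s : 0 <= s <= 1 -> 0 <= step_poly k s <= 1.
Proof.
move=> /andP[s0 s1]; have := exprn_ge0 k s0; have := exprn_ile1 k s0 s1 => p1 p0.
by rewrite exprn_ge0 ?subr_ge0// exprn_ile1// ?subr_ge0// gerBl.
Qed.

(** With [p = s ^+ k] and [n = k * 2 ^ k] one has [n p = k (2 s)^k]. For [s < 1/2], Bernoulli gives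
    [(1 - p)^n >= 1 - n p], and [n p] tends to 0. For [s >= 1/2], [(1 - p)^n (1 + p)^n <= 1] and
    [(1 + p)^n >= 1 + n p >= 1 + k]. *)
Lemma cvg_step_poly s : 0 <= s <= 1 -> step_poly ^~ s @ \oo --> (if s < 2^-1 then 1 else 0 : R).
Proof.
move=> /[dup] s01 /andP[s0 s1]; have Ns k : ((k * 2 ^ k)%:R : R) * s ^+ k = k%:R * (2 * s) ^+ k.
  by rewrite natrM natrX exprMn mulrA.
have sk0 k := exprn_ge0 k s0; have sk1 k := exprn_ile1 k s0 s1.
case: ltP => s2.
  apply: (@squeeze_cvgr _ _ _ _ (fun k => 1 - k%:R * (2 * s) ^+ k) (fun=> 1)).
  - apply: nearW => k; have /andP[_ ->] := step_poly_itv k s01; rewrite andbT -Ns -mulrN.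
    by apply: bernoulli_inequality; rewrite lerN2.
  - rewrite -[X in _ --> X]subr0; apply: cvgB; first exact: cvg_cst.
    by apply: cvg_natmul_expr; lra.
  - exact: cvg_cst.
apply: (@squeeze_cvgr _ _ _ _ (fun=> 0) (fun k => k.+1%:R^-1)).
- apply: nearW => k; have /andP[-> _] := step_poly_itv k s01 => /=.
  rewrite -[leRHS]mul1r ler_pdivlMr//.
  have kN : k.+1%:R <= 1 + (k * 2 ^ k)%:R * s ^+ k :> R.
    rewrite Ns -natr1 addrC lerD2l ler_peMr// exprn_ege1//; lra.
  have := bernoulli_inequality (k * 2 ^ k) (_ : -1 <= s ^+ k) => /(_ _).
  move=> h; apply: (@le_trans _ _ (step_poly k s * (1 + s ^+ k) ^+ (k * 2 ^ k))).
    rewrite ler_wpM2l//; first by have /andP[] := step_poly_itv k s01.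
    by apply: (le_trans kN); apply: h; apply: le_trans (sk0 k).
  rewrite /step_poly -exprMn; apply: exprn_ile1.
    by rewrite mulr_ge0 ?subr_ge0// addr_ge0.
  have := sk0 k; have := sk1 k; move: (s ^+ k) => p; nra.
- exact: cvg_cst.
- exact: cvg_harmonic.
Qed.

End step_approximation.

(** * The closure of the trigonometric polynomials *)

Section approximable.
Import HBNNSimple.
Variable R : realType.
Local Notation T := (measurableTypeR R).
Implicit Types (f g p : T -> R[i]).
Variable nu : {finite_measure set T -> \bar R}.
Hypothesis nu01 : nu (~` `[0%R, 1%R[) = 0%E.

(** The measure [nu] is left general because two instances occur: [leb01], for totality of the
    exponentials, and a sum of two measures, for the comparison with [mu]. *)
Definition approximable f : Prop := cmeasurable f /\
  forall eps : R, 0 < eps ->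
    exists2 p, trigpoly p & (energy nu (fun t => f t - p t)%R <= eps%:E)%E.

Lemma approximable_trigpoly p : trigpoly p -> approximable p.
Proof.
move=> tp; split=> [|eps eps0]; first exact: cmeasurable_trigpoly.
exists p => //; rewrite /energy; under eq_integral do rewrite subrr sq_mod0.
by rewrite integral0 lee_fin ltW.
Qed.

Lemma approximable_limit f : cmeasurable f ->
  (forall eps : R, 0 < eps -> exists2 g, approximable g &
     (energy nu (fun t => f t - g t)%R <= eps%:E)%E) -> approximable f.
Proof.
move=> mf fg; split => // eps eps0.
(* The two quarters are each doubled by [energyD_le]. *)
have [|g [mg gp] hg] := fg (eps / 4); first by rewrite divr_gt0.
have [|p tp hp] := gp (eps / 4); first by rewrite divr_gt0.
exists p => //; have mp := cmeasurable_trigpoly tp.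
have -> : (fun t => f t - p t) = (fun t => (f t - g t) + (g t - p t)).
  by apply/funext => t; rewrite addrA subrK.
apply: (le_trans (energyD_le _ (cmeasurableB mf mg) (cmeasurableB mg mp))).
apply: (@le_trans _ _ ((eps/4)%:E + (eps/4)%:E + ((eps/4)%:E + (eps/4)%:E))%E).
  by rewrite !leeD.
by rewrite -!EFinD lee_fin; lra.
Qed.

Lemma approximableD f g : approximable f -> approximable g ->
  approximable (fun t => f t + g t).
Proof.
move=> [mf fp] [mg gp]; split=> [|eps eps0]; first exact: cmeasurableD.
have [|p tp hp] := fp (eps / 4); first by rewrite divr_gt0.
have [|q tq hq] := gp (eps / 4); first by rewrite divr_gt0.
exists (fun t => p t + q t); first exact: trigpolyD.
have mp := cmeasurable_trigpoly tp; have mq := cmeasurable_trigpoly tq.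
have -> : (fun t => f t + g t - (p t + q t)) = (fun t => (f t - p t) + (g t - q t)).
  by apply/funext => t; rewrite opprD addrACA.
apply: (le_trans (energyD_le _ (cmeasurableB mf mp) (cmeasurableB mg mq))).
apply: (@le_trans _ _ ((eps/4)%:E + (eps/4)%:E + ((eps/4)%:E + (eps/4)%:E))%E).
  by rewrite !leeD.
by rewrite -!EFinD lee_fin; lra.
Qed.

Lemma approximableZ a f : approximable f -> approximable (fun t => a * f t).
Proof.
move=> [mf fp]; split=> [|eps eps0].
  by apply: cmeasurableM => //; exact: cmeasurable_cst.
have a0 : 0 < 1 + sq_mod a by have := sq_mod_ge0 a; lra.
have [|p tp hp] := fp (eps / (1 + sq_mod a)); first by rewrite divr_gt0.
exists (fun t => a * p t); first by apply: trigpolyM => //; exact: trigpoly_cst.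
under [fun _ => _ in X in (X <= _)%E]eq_fun do rewrite -mulrBr.
rewrite energyZ; last exact: cmeasurableB mf (cmeasurable_trigpoly tp).
apply: (@le_trans _ _ ((sq_mod a)%:E * (eps / (1 + sq_mod a))%:E)%E).
  by apply: lee_wpmul2l => //; rewrite lee_fin sq_mod_ge0.
rewrite -EFinM lee_fin mulrCA ger_pMr// ler_pdivrMr//; lra.
Qed.

Lemma approximable_sum (I : Type) (s : seq I) (F : I -> T -> R[i]) :
  (forall i, approximable (F i)) -> approximable (fun t => \sum_(i <- s) F i t).
Proof.
move=> aF; elim: s => [|i s IH].
  by under eq_fun do rewrite big_nil; exact/approximable_trigpoly/trigpoly_cst.
by under eq_fun do rewrite big_cons; exact: approximableD.
Qed.

(** Pointwise control on [[0, 1[] suffices because [nu] has no mass elsewhere. This restriction is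
    essential for rays: the approximants are periodic and can converge to the indicator only on one
    period. *)
Lemma approximable_dominated f (F : nat -> T -> R[i]) (G : T -> R) :
  cmeasurable f -> (forall k, approximable (F k)) ->
  nu.-integrable setT (EFin \o G) ->
  (forall k t, `[0%R, 1%R[%classic t -> sq_mod (f t - F k t) <= G t) ->
  (forall t, `[0%R, 1%R[%classic t -> (fun k => sq_mod (f t - F k t)) @ \oo --> (0 : R)) ->
  approximable f.
Proof.
move=> mf aF iG bnd cv; apply: approximable_limit => // eps eps0.
have mB k : cmeasurable (fun t => f t - F k t) by apply: cmeasurableB => //; case: (aF k).
have ae (P : T -> Prop) : (forall t, `[0%R, 1%R[%classic t -> P t) -> {ae nu, forall t, P t}.
  move=> hP; exists (~` `[0%R, 1%R[); split => //; first exact: measurableC.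
  by move=> t /= nP t01; apply: nP; exact: hP.
have cv0 : {ae nu, forall t, setT t ->
    (fun k => (sq_mod (f t - F k t))%:E) @ \oo --> (0%R)%:E}.
  by apply: ae => t t01 _; apply: cvg_EFin; [exact: nearW|exact: cv].
have bndG : {ae nu, forall t k, setT t -> (`|(sq_mod (f t - F k t))%:E| <= (EFin \o G) t)%E}.
  by apply: ae => t t01 k _; rewrite /= lee_fin ger0_norm ?sq_mod_ge0 ?bnd.
have [_ _] := dominated_convergence measurableT
  (fun k => emeasurable_sq_mod (mB k)) (measurable_cst _) cv0 iG bndG.
rewrite integral0 => /fine_cvgP[fin /cvgrPdist_le/(_ _ eps0)].
move=> /(filterI fin)[K _ /(_ K (leqnn _))/= [finK]].
rewrite sub0r normrN ger0_norm; last by apply: fine_ge0; exact: energy_ge0.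
by move=> le; exists (F K) => //; rewrite -lee_fin fineK in le.
Qed.

Lemma approximable_bounded f (F : nat -> T -> R[i]) (C : R) :
  cmeasurable f -> (forall k, approximable (F k)) ->
  (forall k t, `[0%R, 1%R[%classic t -> sq_mod (f t - F k t) <= C) ->
  (forall t, `[0%R, 1%R[%classic t -> (fun k => sq_mod (f t - F k t)) @ \oo --> (0 : R)) ->
  approximable f.
Proof.
move=> mf aF bnd; apply: (approximable_dominated (G := fun=> C)) => //.
exact: finite_measure_integrable_cst.
Qed.

Let indicator (A : set T) : T -> R[i] := fun t => (\1_A t)%:C.

Lemma cmeasurable_indicator (A : set T) : measurable A -> cmeasurable (indicator A).
Proof. by move=> mA; apply: cmeasurable_real; exact: measurable_indic. Qed.

(* [sep a t - 1/2 = - sin (pi t) sin (pi (t - a)) / 2], so on [[0, 1[ the trigonometric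
   polynomial [sep a] is below [1/2] exactly on []a, 1[]. *)
Let sep (a t : R) : R := 2^-1 + (cos (2 * pi * t - pi * a) - cos (pi * a)) / 4.

Let sep_itv a t : 0 <= sep a t <= 1.
Proof.
have := cos_geN1 (2 * pi * t - pi * a); have := cos_le1 (2 * pi * t - pi * a).
have := cos_geN1 (pi * a); have := cos_le1 (pi * a); rewrite /sep; lra.
Qed.

Let trigpoly_sep a : trigpoly (fun t : T => (sep a t)%:C).
Proof.
pose w : R[i] := cos (pi * a) +i* sin (pi * a).
rewrite (_ : (fun _ => _) = (fun t : T => (2^-1 - cos (pi * a) / 4)%:C +
   ((8^-1%:C * w^* ) * fourier_exp 1 t + (8^-1%:C * w) * fourier_exp (-1) t))).
  by apply: trigpolyD; [exact: trigpoly_cst|apply: trigpolyD; exact: trigpoly_exp].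
apply/funext => t; rewrite fourier_expN /fourier_exp/= /sep mulr1 cosB.
by apply/eqP; rewrite eq_complex/=; apply/andP; split; apply/eqP; field.
Qed.

Let sep_lt a t : 0 <= a < 1 -> 0 <= t < 1 -> (sep a t < 2^-1) = (a < t).
Proof.
move=> /andP[a0 a1] /andP[t0 t1]; have pi0 := pi_gt0 R.
have -> : sep a t = 2^-1 - sin (pi * t) * sin (pi * (t - a)) / 2.
  rewrite /sep; have -> : 2 * pi * t - pi * a = pi * t + pi * (t - a) by ring.
  have -> : pi * a = pi * t - pi * (t - a) by ring.
  by rewrite cosD cosB; field.
have -> : 2^-1 - sin (pi * t) * sin (pi * (t - a)) / 2 < 2^-1 =
    (0 < sin (pi * t) * sin (pi * (t - a))) by apply/idP/idP; lra.
have sin_pos (y : R) : 0 < y < 1 -> 0 < sin (pi * y).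
  move=> /andP[y0 y1]; apply: sin_gt0_pi.
  by rewrite mulr_gt0//= -[ltRHS]mulr1 ltr_pM2l.
have [->|t_neq0] := eqVneq t 0; first by rewrite mulr0 sin0 mul0r ltxx ltNge a0.
have tgt0 : 0 < t by rewrite lt_neqAle eq_sym t_neq0.
rewrite (pmulr_rgt0 _ (sin_pos t _)) ?tgt0//; case: (ltgtP a t) => [at_|ta|at_].
- by rewrite sin_pos//; lra.
- rewrite -opprB mulrN sinN oppr_gt0; apply/negbTE; rewrite -leNgt.
  by apply/ltW/sin_pos; lra.
- by rewrite at_ subrr mulr0 sin0 ltxx.
Qed.

Lemma approximable_ray a : approximable (indicator `]a, +oo[).
Proof.
have mA : measurable (`]a, +oo[ : set T) by exact: measurable_itv.
have in01 (t : R) : `[0%R, 1%R[%classic t -> 0 <= t < 1 by rewrite /= in_itv.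
have rayE (t : R) : \1_(`]a, +oo[ : set T) t = (a < t)%R%:R :> R.
  by rewrite indicE mem_setE in_itv/= andbT.
(* For [a < 0] or [a >= 1] the indicator of the ray is constant on [[0, 1[], and [sep] is needed
   only for the remaining [a]. *)
have null (b : bool) : (forall t, `[0%R, 1%R[%classic t -> (a < t) = b) ->
    approximable (indicator `]a, +oo[).
  move=> hb; apply: (approximable_bounded (F := fun _ _ => b%:R) (C := 0)).
  - exact: cmeasurable_indicator.
  - by move=> _; exact/approximable_trigpoly/trigpoly_cst.
  - by move=> _ t /hb; rewrite /indicator rayE => ->; case: b {hb}; rewrite subrr sq_mod0.
  - move=> t /hb; rewrite /indicator rayE => ->; case: b {hb}; rewrite subrr sq_mod0; exact: cvg_cst.
have [a0|a0] := ltP a 0; first by apply: (null true) => t /in01/andP[t0 _]; exact: lt_le_trans t0.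
have [a1|a1] := leP 1 a.
  by apply: (null false) => t /in01/andP[_ t1]; apply/negbTE; rewrite -leNgt; apply: le_trans a1; exact: ltW.
have diffE t k : indicator `]a, +oo[ t - (step_poly k (sep a t))%:C =
    ((if a < t then 1 else 0) - step_poly k (sep a t))%:C.
  by rewrite /indicator rayE rmorphB; case: ltP.
apply: (approximable_bounded (F := fun k t => (step_poly k (sep a t))%:C) (C := 1)).
- exact: cmeasurable_indicator.
- move=> k; apply: approximable_trigpoly; rewrite /step_poly.
  under eq_fun do rewrite rmorphXn rmorphB rmorphXn rmorph1.
  apply/trigpolyX/trigpolyB; first exact: trigpoly_cst.
  exact/trigpolyX/trigpoly_sep.
- move=> k t _; rewrite diffE sq_modE/= [0 ^+ 2]expr0n/= addr0.
  have := step_poly_itv k (sep_itv a t); move: (step_poly _ _) => p /andP[p0 p1].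
  by case: ifP => _; nra.
- move=> t /in01 t01; pose l : R := if a < t then 1 else 0.
  have h : (fun k => step_poly k (sep a t)) @ \oo --> l.
    by have := cvg_step_poly (sep_itv a t); rewrite sep_lt ?a0.
  rewrite (_ : (fun _ => _) = (fun k => (l - step_poly k (sep a t)) * (l - step_poly k (sep a t)))).
    by have := cvgM (cvgB (cvg_cst l) h) (cvgB (cvg_cst l) h); rewrite subrr mulr0; exact.
  by apply/funext => k; rewrite diffE sq_modE/= [0 ^+ 2]expr0n/= addr0 expr2.
Qed.

(** Dynkin's pi-lambda theorem: open rays are stable under intersection and generate the Borel sets,
    while approximability passes to complements and countable disjoint unions. *)
Lemma approximable_indicator (A : set T) : measurable A -> approximable (indicator A).
Proof.
pose P (A : set T) := approximable (indicator A).
have mE : @measurable _ T = <<s @RGenOInfty.G R >> by exact: RGenOInfty.measurableE.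
move=> mA; apply: (@dynkin_induction _ T (@RGenOInfty.G R) P mE); last by rewrite -mE.
- move=> _ _ [x ->] [y ->]; exists (Num.max x y); apply/seteqP; split => t /=;
    rewrite !in_itv/= !andbT gt_max; first by move=> [-> ->].
  by move=> /andP[].
- rewrite /P (_ : indicator _ = fun=> 1); first exact/approximable_trigpoly/trigpoly_cst.
  by apply/funext => t; rewrite /indicator indicT.
- by move=> _ [x ->]; exact: approximable_ray.
- move=> S mS PS; rewrite /P (_ : indicator _ = fun t => 1 + (-1) * indicator S t).
    apply: approximableD; last exact: approximableZ.
    exact/approximable_trigpoly/trigpoly_cst.
  apply/funext => t; rewrite /indicator !indicE in_setC.
  by case: (t \in S); rewrite /= ?(mulr1, mulr0, subrr, addr0).
- move=> F mF tF PF; rewrite /P.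
  (* By disjointness at most one [F n] contains [t], so the error of the [k]-th partial sum is 1 up
     to [k = n] and 0 afterwards: bounded by 1 and eventually 0. *)
  have diffE t : exists b : nat -> bool, (\forall k \near \oo, b k = false) /\
      forall k, indicator (\bigcup_k F k) t - \sum_(i <- iota 0 k) indicator (F i) t = (b k)%:R.
    have [[n _ Fnt]|Ft] := pselect ((\bigcup_k F k) t); last first.
      exists (fun=> false); split=> [|k]; first exact: nearW.
      rewrite /indicator indicE memNset// big1 ?subrr// => i _.
      by rewrite indicE memNset// => Fit; apply: Ft; exists i.
    have FE i : indicator (F i) t = (i == n)%:R.
      rewrite /indicator indicE; case: eqP => [->|ni]; first by rewrite mem_set.
      rewrite memNset// => Fit; apply: ni; apply: tF => //; exists t; split => //.
    exists (fun k => (k <= n)%N); split=> [|k].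
      by exists n.+1 => // k /= nk; rewrite leqNgt nk.
    rewrite /indicator indicE mem_set; last by exists n.
    under eq_bigr do rewrite -/(indicator _ _) FE.
    case: leqP => kn.
      rewrite big_seq big1 ?subr0// => i; rewrite mem_iota add0n => /andP[_ ik].
      by case: eqP => // ni; move: ik; rewrite ni ltnNge kn.
    rewrite (bigD1_seq n) ?iota_uniq ?mem_iota//= eqxx big1 ?addr0 ?subrr// => i /negbTE ->.
    by [].
  apply: (approximable_bounded (F := fun k t => \sum_(i <- iota 0 k) indicator (F i) t) (C := 1)).
  + by apply: cmeasurable_indicator; exact: bigcup_measurable.
  + by move=> k; exact: approximable_sum.
  + move=> k t _; have [b [_ ->]] := diffE t.
    by case: (b k); rewrite sq_modE/= ?expr1n ?expr0n/= ?addr0.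
  + move=> t _; have [b [nb bE]] := diffE t; apply: cvg_near_cst.
    by apply: filterS nb => k bk; rewrite bE bk sq_mod0.
Qed.

Lemma approximable_nonneg (h : T -> R) : measurable_fun setT h -> (forall t, 0 <= h t) ->
  nu.-integrable setT (fun t => (h t ^+ 2)%:E) -> approximable (fun t => (h t)%:C).
Proof.
move=> mh h0 ih; have mh' : measurable_fun setT (EFin \o h) by exact/measurable_EFinP.
pose s := nnsfun_approx measurableT mh'.
have cv t : (fun k => s k t) @ \oo --> h t.
  have := @cvg_nnsfun_approx _ _ _ _ measurableT _ mh' (fun x _ => h0 x) t I.
  by move=> /fine_cvgP[_].
have sh k t : s k t <= h t.
  rewrite -(cvg_lim (@norm_hausdorff _ _) (cv t)).
  apply: (nondecreasing_cvgn_le _ (cvgP _ (cv t))) => m n mn.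
  exact/lefP/nd_nnsfun_approx.
have dE t k : sq_mod ((h t)%:C - (s k t)%:C) = (h t - s k t) * (h t - s k t).
  by rewrite -rmorphB sq_modE/= [0 ^+ 2]expr0n/= addr0 expr2.
apply: (approximable_dominated (F := fun k t => (s k t)%:C) (G := fun t => h t ^+ 2)) => //.
- move=> k; under eq_fun => t do rewrite (fimfunE (s k) t) fsbig_finite//= rmorph_sum.
  apply: approximable_sum => y; under eq_fun do rewrite rmorphM.
  by apply: approximableZ; apply: approximable_indicator.
- move=> k t _; rewrite dE; have := sh k t; have : 0 <= s k t by []; have := h0 t.
  by move: (s k t) => a; nra.
- move=> t _; under eq_fun do rewrite dE.
  have c : (fun k => h t - s k t) @ \oo --> h t - h t.
    by apply: cvgB (cv t); exact: cvg_cst.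
  by have := cvgM c c; rewrite subrr mulr0; exact.
Qed.

End approximable.

Section fourier_L2.
Variable R : realType.
Local Notation T := (measurableTypeR R).
Implicit Types (f g p : T -> R[i]).
Variable nu : {finite_measure set T -> \bar R}.
Hypothesis nu01 : nu (~` `[0%R, 1%R[) = 0%E.

Lemma L2_fourier_exp n : L2 nu (@fourier_exp R n).
Proof.
apply/L2P; split; first exact: cmeasurable_fourier_exp.
rewrite /energy; under eq_integral do rewrite sq_mod_fourier_exp.
by rewrite integral_cst//= mul1e ltey_eq fin_num_measure.
Qed.

Lemma L2_trigpoly p : trigpoly p -> L2 nu p.
Proof.
elim=> [|n a h _ IH]; first exact: L2_0.
by apply: L2D => //; apply: L2Z; exact: L2_fourier_exp.
Qed.

Lemma approximable_real (h : T -> R) : measurable_fun setT h ->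
  nu.-integrable setT (fun t => (h t ^+ 2)%:E) -> approximable nu (fun t => (h t)%:C).
Proof.
move=> mh ih.
have part (k : T -> R) : measurable_fun setT k -> (forall t, k t ^+ 2 = h t ^+ 2) ->
    approximable nu (fun t => (Num.max (k t) 0)%:C).
  move=> mk kh; have mm : measurable_fun setT (fun t => Num.max (k t) 0).
    by apply: measurable_maxr => //; exact: measurable_cst.
  apply: approximable_nonneg => //; first by move=> t; rewrite le_max lexx orbT.
  apply: le_integrable ih => //; first by apply/measurable_EFinP/measurable_funX.
  move=> t _ /=; rewrite lee_fin !ger0_norm ?sqr_ge0// -kh.
  by rewrite maxEle; case: ifP => _; rewrite ?lexx// expr0n/= sqr_ge0.
rewrite (_ : (fun _ => _) = (fun t => (Num.max (h t) 0)%:C + (-1) * (Num.max (- h t) 0)%:C)).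
  apply: approximableD; first exact: part.
  by apply/approximableZ/part; [exact: measurable_funN|move=> t; rewrite sqrrN].
apply/funext => t; rewrite mulN1r -rmorphN -rmorphD; congr (_%:C).
by rewrite !maxEle; case: (leP (h t) 0) => h1; case: (leP (- h t) 0) => h2; lra.
Qed.

Lemma approximable_L2 x : L2 nu x -> approximable nu x.
Proof.
move=> /L2P[[m1 m2] xoo].
have ix : nu.-integrable setT (fun t => (sq_mod (x t))%:E).
  apply/integrableP; split; first exact: emeasurable_sq_mod.
  by under eq_integral do rewrite gee0_abs ?lee_fin ?sq_mod_ge0//.
have part (k : T -> R) : measurable_fun setT k -> (forall t, k t ^+ 2 <= sq_mod (x t)) ->
    approximable nu (fun t => (k t)%:C).
  move=> mk kx; apply: approximable_real => //.
  apply: le_integrable ix => //; first by apply/measurable_EFinP/measurable_funX.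
  by move=> t _ /=; rewrite lee_fin !ger0_norm ?sqr_ge0 ?sq_mod_ge0.
rewrite (_ : x = (fun t => (complex.Re (x t))%:C + 'i%C * (complex.Im (x t))%:C)).
  apply: approximableD; first by apply: part => // t; rewrite sq_modE lerDl sqr_ge0.
  by apply/approximableZ/part => // t; rewrite sq_modE lerDr sqr_ge0.
by apply/funext => t; rewrite -complexE.
Qed.

Lemma fourier_total x (eps : R) : L2 nu x -> 0 < eps ->
  exists c M0, forall M, (M0 <= M)%N ->
    sq_norm (L2_ip nu) (x - psum (fun n => c n *: @fourier_exp R n) M) < eps.
Proof.
move=> Lx eps0; have [_ /(_ (eps / 2))[|p tp hp]] := approximable_L2 Lx.
  by rewrite divr_gt0.
have [c [M0 hM]] := trigpoly_psum tp; exists c, M0 => M /hM <-.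
have Lxp : L2 nu (x - p) := pre_hilbertB (L2_pre_hilbert nu) Lx (L2_trigpoly tp).
rewrite -lte_fin (L2_sq_normE Lxp); apply: (le_lt_trans hp).
by rewrite lte_fin; lra.
Qed.

End fourier_L2.

Lemma integral_concentrated d (T : measurableType d) (R : realType)
    (nu : {measure set T -> \bar R}) (S : set T) (f : T -> \bar R) :
  measurable S -> nu (~` S) = 0%E -> measurable_fun setT f ->
  (\int[nu]_t f t = \int[nu]_(t in S) f t)%E.
Proof.
move=> mS nuS mf; rewrite integralE [RHS]integralE.
have ge0 (h : T -> \bar R) : measurable_fun setT h -> (forall t, 0 <= h t)%E ->
    (\int[nu]_t h t = \int[nu]_(t in S) h t)%E.
  move=> mh h0; rewrite (ge0_negligible_integral (measurableC mS))//.
  by rewrite setDE setTI setCK.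
by congr (_ - _)%E; apply: ge0; [exact: measurable_funepos|exact: funepos_ge0|
  exact: measurable_funeneg|exact: funeneg_ge0].
Qed.

(** * Lebesgue measure on the unit interval and orthonormality of the exponentials *)

Section unit_interval.
Variable R : realType.
Local Notation T := (measurableTypeR R).
Local Notation e := (@fourier_exp R).

Lemma lebesgue_unit_itv : lebesgue_measure (`[0, 1[ : set T) = 1%:E :> \bar R.
Proof. by rewrite lebesgue_measure_itv/= lte_fin ltr01 oppr0 adde0. Qed.

Lemma lebesgue_unit_itv_lty : (lebesgue_measure (`[0%R, 1%R[ : set T) < +oo :> \bar R)%E.
Proof. by rewrite lebesgue_unit_itv ltry. Qed.

Lemma measurable_unit_itv : measurable (`[0%R, 1%R[ : set T).
Proof. exact: measurable_itv. Qed.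

(** Kept as a measure on the whole line so that it acts on the same functions as [mu] and can be
    added to it. *)
Definition leb01 : {finite_measure set T -> \bar R} :=
  mfrestr measurable_unit_itv lebesgue_unit_itv_lty.

Lemma leb01E (A : set T) : leb01 A = lebesgue_measure (A `&` `[0%R, 1%R[).
Proof. by []. Qed.

Lemma leb01_unit_itvC : leb01 (~` `[0%R, 1%R[) = 0%E.
Proof. by rewrite leb01E setICl measure0. Qed.

Lemma integral_leb01 (f : T -> \bar R) : measurable_fun setT f ->
  (\int[leb01]_t f t = \int[lebesgue_measure]_(t in `[0%R, 1%R[) f t)%E.
Proof.
move=> mf; rewrite (integral_concentrated measurable_unit_itv leb01_unit_itvC mf).
by apply: eq_measure_integral => A mA A01; rewrite /leb01/= /mfrestr /mrestr setIidl.
Qed.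

Lemma integral_leb01_derivative (f F : R -> R) :
  measurable_fun setT (f : T -> R) -> (forall x : R, is_derive x 1 F (f x)) ->
  continuous f -> (\int[leb01]_t (f t)%:E = (F 1 - F 0)%:E)%E.
Proof.
move=> mf dF cf; rewrite integral_leb01; last exact/measurable_EFinP.
rewrite integral_itv_bndo_bndc; last by apply/measurable_funTS/measurable_EFinP.
rewrite (@continuous_FTC2 _ f F 0 1) ?ltr01//.
- exact: continuous_subspaceT.
- have cF x : {for x, continuous F}.
    by apply: differentiable_continuous; apply/derivable1_diffP; apply: ex_derive.
  split => [x _||]; first exact: ex_derive.
  + exact/cvg_at_right_filter/cF.
  + exact/cvg_at_left_filter/cF.
- by move=> x _; rewrite derive1E; apply: derive_val.
Qed.

Lemma fourier_exp_1 k : e k 1 = 1.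
Proof.
have nat_case (j : nat) : e j 1 = 1.
  elim: j => [|j IH]; first exact: fourier_exp0.
  rewrite -addn1 PoszD fourier_expD IH mul1r /fourier_exp !mulr1 mulr_natl.
  by rewrite cos2pi sin2pi.
by case: k => j; rewrite ?NegzE ?fourier_expN nat_case ?conjc1.
Qed.

Lemma fourier_orthonormal m n : L2_ip leb01 (e m) (e n) = (n == m)%:R.
Proof.
rewrite /L2_ip (_ : (fun t => _) = e (m - n)); last first.
  by apply/funext => t; rewrite fourier_expD fourier_expN.
rewrite (_ : (n == m) = (m - n == 0)); last by rewrite subr_eq0 eq_sym.
move: (m - n) => k {m n}.
rewrite /Cintegral /Rintegral /=; have [->|k0] := eqVneq k 0.
  under eq_integral do rewrite mulr0 mul0r cos0.
  under [X in _ +i* fine X]eq_integral do rewrite mulr0 mul0r sin0.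
  by rewrite integral0 integral_cst// mul1e/= leb01E setTI lebesgue_unit_itv.
pose w : R := 2 * pi * k%:~R.
have w0 : w != 0.
  by rewrite /w !mulf_neq0 ?intr_eq0// ?pnatr_eq0// gt_eqF// pi_gt0.
have mw : measurable_fun setT (fun t : T => w * t : R) by exact: measurable_funM.
have cw : continuous (fun t : R => w * t) by move=> x; apply: cvgMl_tmp; exact: cvg_id.
have dw (x : R) : is_derive x 1 (fun t : R => w * t) w.
  by apply: (is_derive_eq (is_deriveZ w (is_derive_id x 1))); exact: mulr1.
(* Periodicity: the antiderivatives below take equal values at 0 and 1. *)
have [cos1 sin1] : cos (w * 1) = 1 /\ sin (w * 1) = 0.
  by have := fourier_exp_1 k; rewrite /fourier_exp -/w => -[].
have int_cos : (\int[leb01]_t (cos (w * t))%:E =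
    (w^-1 * sin (w * 1) - w^-1 * sin (w * 0))%:E)%E.
  apply: (@integral_leb01_derivative (fun t => cos (w * t)) (fun t => w^-1 * sin (w * t))).
  - by apply: (measurableT_comp _ mw); apply: continuous_measurable_fun; exact: continuous_cos.
  - move=> x; have h := is_deriveZ w^-1 (is_derive1_comp (is_derive_sin (w * x)) (dw x)).
    by apply: (is_derive_eq h); rewrite /GRing.scale/= mulrCA mulVf// mulr1.
  - by move=> x; apply: continuous_comp; [exact: cw|exact: continuous_cos].
have int_sin : (\int[leb01]_t (sin (w * t))%:E =
    (- w^-1 * cos (w * 1) - - w^-1 * cos (w * 0))%:E)%E.
  apply: (@integral_leb01_derivative (fun t => sin (w * t)) (fun t => - w^-1 * cos (w * t))).
  - by apply: (measurableT_comp _ mw); apply: continuous_measurable_fun; exact: continuous_sin.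
  - move=> x; have h := is_deriveZ (- w^-1) (is_derive1_comp (is_derive_cos (w * x)) (dw x)).
    by apply: (is_derive_eq h); rewrite /GRing.scale/= mulNr mulNr mulrN opprK mulrCA mulVf// mulr1.
  - by move=> x; apply: continuous_comp; [exact: cw|exact: continuous_sin].
by rewrite int_cos int_sin cos1 sin1 !mulr0 sin0 cos0 mulr0 !subrr.
Qed.

End unit_interval.
Arguments leb01 {R}.

(** * The dual Riesz basis of a bounded density *)

Section bounded_density.
Variable R : realType.
Local Notation T := (measurableTypeR R).
Local Notation e := (@fourier_exp R).
Variables (mu : {finite_measure set T -> \bar R}) (F : T -> R) (m M : R).
Hypothesis mF : measurable_fun setT F.
Hypothesis m0 : 0 < m.
Hypothesis mFM : forall t, m <= F t <= M.
Hypothesis density : forall h : T -> \bar R, measurable_fun setT h -> (forall t, 0 <= h t)%E ->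
  (\int[mu]_t h t = \int[leb01]_t (h t * (F t)%:E))%E.

Let F0 t : 0 < F t. Proof. by apply: lt_le_trans m0 _; case/andP: (mFM t). Qed.

Lemma integral_density (h : T -> \bar R) : measurable_fun setT h ->
  (\int[mu]_t h t = \int[leb01]_t (h t * (F t)%:E))%E.
Proof.
move=> mh; rewrite integralE [RHS]integralE.
rewrite density; [|exact: measurable_funepos|exact: funepos_ge0].
rewrite density; [|exact: measurable_funeneg|exact: funeneg_ge0].
congr (_ - _)%E; apply: eq_integral => t _.
  by rewrite !funeposE maxe_pMl ?mul0e// lee_fin ltW.
by rewrite !funenegE -mulNe maxe_pMl ?mul0e// lee_fin ltW.
Qed.

Lemma energy_density_bounds x : cmeasurable x ->
  ((m%:E * energy leb01 x <= energy mu x) /\ (energy mu x <= M%:E * energy leb01 x))%E.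
Proof.
move=> mx; have msq := emeasurable_sq_mod mx.
have mFsq : measurable_fun setT (fun t => (sq_mod (x t))%:E * (F t)%:E)%E.
  by apply: emeasurable_funM => //; exact/measurable_EFinP.
have s0 t : [set: T] t -> (0 <= (sq_mod (x t))%:E)%E by rewrite lee_fin sq_mod_ge0.
have M0 : 0 <= M by have /andP[h1 h2] := mFM 0; exact: le_trans (ltW m0) (le_trans h1 h2).
have F0s t : [set: T] t -> (0 <= (sq_mod (x t))%:E * (F t)%:E)%E.
  by move=> _; rewrite -EFinM lee_fin mulr_ge0 ?sq_mod_ge0 ?(ltW (F0 _)).
have cs0 c t : 0 <= c -> [set: T] t -> (0 <= c%:E * (sq_mod (x t))%:E)%E.
  by move=> c0 _; rewrite -EFinM lee_fin mulr_ge0 ?sq_mod_ge0.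
have mcs c : measurable_fun setT (fun t => c%:E * (sq_mod (x t))%:E)%E.
  by apply: emeasurable_funM => //; exact: measurable_cst.
rewrite /energy (integral_density msq) -!ge0_integralZl_EFin ?(ltW m0)//.
split; apply: ge0_le_integral => //.
- by move=> t; apply: cs0; exact: ltW.
- by move=> t _; rewrite -!EFinM lee_fin mulrC ler_wpM2l ?sq_mod_ge0; case/andP: (mFM t).
- by move=> t _; rewrite -!EFinM lee_fin [leRHS]mulrC ler_wpM2l ?sq_mod_ge0; case/andP: (mFM t).
Qed.

Lemma L2_density x : L2 mu x <-> L2 leb01 x.
Proof.
have fine_energy (nu : {measure set T -> \bar R}) y : (energy nu y < +oo)%E ->
    exists r, energy nu y = r%:E.
  by move=> yoo; exists (fine (energy nu y)); rewrite fineK// ge0_fin_numE// energy_ge0.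
split=> /L2P[mx xoo]; have [lb ub] := energy_density_bounds mx; apply/L2P; split => //.
  rewrite ltey; apply/eqP => xy; move: lb xoo; rewrite xy gt0_muley ?lte_fin//.
  by rewrite leye_eq => /eqP ->.
by apply: (le_lt_trans ub); have [r ->] := fine_energy _ _ xoo; rewrite -EFinM ltry.
Qed.

Lemma sq_norm_density_bounds x : L2 mu x ->
  m * sq_norm (L2_ip leb01) x <= sq_norm (L2_ip mu) x <= M * sq_norm (L2_ip leb01) x.
Proof.
move=> Lx; have [lb ub] := energy_density_bounds (L2_cmeasurable Lx).
by rewrite -!lee_fin !EFinM !L2_sq_normE//; [rewrite lb ub|exact/L2_density].
Qed.

Definition dual_exp (n : int) : T -> R[i] := fun t => ((F t)^-1)%:C * e n t.

Lemma cmeasurable_dual_exp n : cmeasurable (dual_exp n).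
Proof.
apply: cmeasurableM; last exact: cmeasurable_fourier_exp.
(* Inversion is not continuous at 0. Replacing its argument by the maximum with [m] changes nothing
   on the values of [F] and gives a continuous function on the whole line. *)
apply: cmeasurable_real; rewrite (_ : (fun _ => _) = (fun x => (Num.max m x)^-1) \o F).
  apply: measurableT_comp mF; apply: continuous_measurable_fun => x.
  by apply: cvgV; [rewrite gt_eqF// lt_max m0|apply: continuous_max; [exact: cvg_cst|exact: cvg_id]].
by apply/funext => t /=; rewrite max_r//; case/andP: (mFM t).
Qed.

Lemma L2_dual_exp n : L2 mu (dual_exp n).
Proof.
apply/L2_density/L2P; split; first exact: cmeasurable_dual_exp.
apply: (@le_lt_trans _ _ (\int[leb01]_(t in [set: T]) (m^-1 ^+ 2)%:E)%E).
  apply: ge0_le_integral => //.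
  - by move=> t _; rewrite lee_fin sq_mod_ge0.
  - exact/emeasurable_sq_mod/cmeasurable_dual_exp.
  - move=> t _; rewrite lee_fin /dual_exp sq_modM sq_mod_fourier_exp mulr1.
    rewrite sq_modE/= [0 ^+ 2]expr0n/= addr0 ler_sqr ?nnegrE ?invr_ge0 ?(ltW m0) ?(ltW (F0 _))//.
    by rewrite lef_pV2 ?posrE//; case/andP: (mFM t).
by rewrite integral_cst// ltey_eq fin_numM// fin_num_measure.
Qed.

Lemma ip_dual_exp x n : L2 mu x -> L2_ip mu x (dual_exp n) = L2_ip leb01 x (e n).
Proof.
move=> Lx; have mx := L2_cmeasurable Lx.
have [mR mI] := cmeasurableM mx (cmeasurable_conj (cmeasurable_dual_exp n)).
rewrite /L2_ip /Cintegral /Rintegral.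
rewrite integral_density; last exact/measurable_EFinP.
rewrite [X in _ +i* fine X]integral_density; last exact/measurable_EFinP.
congr (fine _ +i* fine _); apply: eq_integral => t _; rewrite -EFinM /dual_exp; congr (_%:E);
  case: (x t) => a b; case: (e n t) => c d /=; field; exact: lt0r_neq0.
Qed.

Lemma dual_exp_riesz_dextrodual :
  dextrodual (L2 mu) (L2_ip mu) dual_exp e /\ is_riesz_basis (L2 mu) (L2_ip mu) dual_exp.
Proof.
have HV := L2_pre_hilbert mu.
have HV1 := L2_pre_hilbert (leb01 : {measure set T -> \bar R}).
have Le1 n : L2 leb01 (e n) by apply: L2_fourier_exp.
have Le n : L2 mu (e n) by exact/L2_density.
have M0 : 0 < M by apply: (lt_le_trans (F0 0)); case/andP: (mFM 0).
have orth := @fourier_orthonormal R.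
have total x eps := @fourier_total R leb01 (leb01_unit_itvC R) x eps.
split.
  split=> [n|n|x Lx]; [exact: L2_dual_exp|exact: Le|].
  have Lx1 := (L2_density x).1 Lx.
  have Hu n : L2 mu (L2_ip mu x (dual_exp n) *: e n) by exact: (pre_hilbertZ HV).
  have Hu1 n : L2 leb01 (L2_ip leb01 x (e n) *: e n) by exact: (pre_hilbertZ HV1).
  apply/(sym_sum_toP HV Hu Lx) => eps eps0.
  (* The Fourier series converges in [L2 leb01]; passing to the norm of [L2 mu] costs a factor
     [M]. *)
  have /(sym_sum_toP HV1 Hu1 Lx1)/(_ (eps / M))[|M0' hM] := fourier_expansion HV1 Le1 orth total Lx1.
    by rewrite divr_gt0.
  exists M0' => k /hM le.
  rewrite (@psum_ext _ _ (fun n => L2_ip leb01 x (e n) *: e n)); last first.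
    by move=> n _; rewrite ip_dual_exp.
  have Lxs : L2 mu (x - psum (fun n => L2_ip leb01 x (e n) *: e n) k).
    apply/L2_density/(pre_hilbertB HV1) => //; exact: (pre_hilbert_psum HV1).
  have /andP[_ ub] := sq_norm_density_bounds Lxs; apply: (le_trans ub).
  by rewrite mulrC -ler_pdivlMr.
split.
  split=> [n|]; first exact: L2_dual_exp.
  (* By Parseval the frame sum is the squared norm in [L2 leb01], which lies between [M^-1] and
     [m^-1] times the squared norm in [L2 mu]. *)
  exists M^-1, m^-1; split; rewrite ?invr_gt0// => f Lf.
  have Lf1 := (L2_density f).1 Lf; have /andP[lb ub] := sq_norm_density_bounds Lf.
  have := parseval HV1 Le1 orth total Lf1.
  rewrite /sqsum; under eq_esum do rewrite -ip_dual_exp//.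
  rewrite (ip_norm_sqr HV)// => ->; rewrite !lee_fin; split.
    by rewrite ler_pdivrMl.
  by rewrite ler_pdivlMl.
move=> c _ /(sym_sum_toP HV _ (pre_hilbert0 HV)) hc k.
have {}hc := hc (fun n => pre_hilbertZ HV (c n) (L2_dual_exp n)).
have Nk0 := sq_norm_ge0 HV (Le k).
have Lc n : L2 mu (c n *: dual_exp n) := pre_hilbertZ HV (c n) (L2_dual_exp n).
apply: sq_mod_eq0; apply/eqP; rewrite eq_le sq_mod_ge0 andbT; apply/ler_addgt0Pr => eps eps0.
rewrite add0r; have [|M0' hM] := hc (eps / (1 + sq_norm (L2_ip mu) (e k))).
  by rewrite divr_gt0// ltr_pwDl.
have := hM (maxn M0' (absz k)) (leq_maxl _ _); set s := psum _ _.
have Ls : L2 mu s by exact: (pre_hilbert_psum HV).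
rewrite sub0r (sq_normN HV)// => Ns.
(* The exponentials are biorthogonal to [dual_exp] in [L2 mu], so pairing a long partial sum with
   [e k] extracts [c k]; Cauchy-Schwarz then bounds it by the small norm of that sum. *)
have <- : L2_ip mu s (e k) = c k.
  rewrite (ip_psuml HV)// (@psum_ext _ _ (fun n => if n == k then c k else 0)).
    by rewrite psum_delta// leq_maxr.
  move=> n _; rewrite (ipZl HV)//; last exact: L2_dual_exp.
  rewrite (ipC HV (Le k) (L2_dual_exp n)) ip_dual_exp// orth.
  by case: eqP => [->|_]; rewrite ?conjc1 ?mulr1 ?conjc0 ?mulr0.
apply: (le_trans (cauchy_schwarz HV Ls (Le k))).
move: Ns; rewrite ler_pdivlMr ?ltr_pwDl//; apply: le_trans.
by rewrite ler_wpM2l ?lerDr ?(sq_norm_ge0 HV Ls).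
Qed.

End bounded_density.

(** * Comparison with Lebesgue measure *)

Section radon_nikodym_density.
Variable R : realType.
Local Notation T := (measurableTypeR R).
Local Notation leb := (@lebesgue_measure R).
Variable mu : {finite_measure set T -> \bar R}.
Hypothesis mu01 : mu (~` `[0%R, 1%R[) = 0%E.

Lemma radon_nikodym_bounded_density (m M : R) : mu `<< leb -> m <= M ->
  {ae leb, forall x, `[0%R, 1%R[%classic x ->
    (m%:E <= ('d (charge_of_finite_measure mu) '/d leb) x
     /\ ('d (charge_of_finite_measure mu) '/d leb) x <= M%:E)%E} ->
  exists F : T -> R, [/\ measurable_fun setT F, forall t, m <= F t <= M &
    forall h : T -> \bar R, measurable_fun setT h -> (forall t, 0 <= h t)%E ->
      (\int[mu]_t h t = \int[leb01]_t (h t * (F t)%:E))%E].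
Proof.
move=> mul mM bnd; set W := Radon_Nikodym _ _ in bnd.
have Wfin x : W x \is a fin_num by exact: Radon_Nikodym_fin_num.
have mW : measurable_fun setT W by apply: measurable_int; exact: Radon_Nikodym_integrable.
(* Clamping the derivative to [[m, M]] alters it on [[0, 1[] only on a null set and makes the bounds
   hold everywhere, as [dual_exp] requires. *)
pose F t := Num.max m (Num.min M (fine (W t))).
have mF : measurable_fun setT F.
  apply: measurable_maxr; first exact: measurable_cst.
  apply: measurable_minr; first exact: measurable_cst.
  exact: (measurableT_comp (fine_measurable measurableT) mW).
exists F; split => // [t|h mh h0].
  by rewrite /F le_max lexx/= ge_max mM ge_min lexx.
have mhF : measurable_fun setT (fun t => h t * (F t)%:E)%E.
  by apply: emeasurable_funM => //; exact/measurable_EFinP.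
rewrite (integral_concentrated (@measurable_unit_itv R) mu01 mh) integral_leb01//.
rewrite -(Radon_Nikodym_SigmaFinite.change_of_variables mul)//; last exact: measurable_funTS.
apply: ae_eq_integral => //.
- apply: emeasurable_funM; apply: measurable_funTS => //.
  exact: measurable_int (Radon_Nikodym_SigmaFinite.f_integrable mul).
- exact: measurable_funTS.
(* The change of variables uses the density of the sigma-finite construction, which has to be
   identified almost everywhere with [W]. *)
have RNE := ae_eq_Radon_Nikodym_SigmaFinite mul (@measurable_unit_itv R).
apply: (@filterS2 _ _ (ae_filter_ringOfSetsType leb) _ _ _ _ bnd RNE) => x bx RNx x01.
rewrite RNx// -/W; have [lb ub] := bx x01; congr (_ * _)%E.
move: lb ub; rewrite -(fineK (Wfin x)) !lee_fin => lb ub.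
by rewrite /F min_r// max_r.
Qed.

Lemma measure0_integral_le0 (nu : {measure set T -> \bar R}) (E : set T) (h : T -> \bar R) :
  measurable E -> measurable_fun E h -> (forall t, E t -> 0 < h t)%E ->
  (\int[nu]_(t in E) h t <= 0)%E -> nu E = 0%E.
Proof.
move=> mE mh h0 le0.
have /(ae_eq_integral_abs nu mE mh) [N [mN N0 sN]] : (\int[nu]_(x in E) `|h x| = 0)%E.
  apply/eqP; rewrite eq_le integral_ge0// andbT.
  by rewrite (eq_integral h)// => t /set_mem Et; rewrite gte0_abs// h0.
apply: (subset_measure0 mE mN _ N0) => t Et; apply: sN => /= /(_ Et) ht0.
by have := h0 t Et; rewrite ht0 ltxx.
Qed.

Lemma comparable_radon_nikodym (A B : R) : 0 < A -> 0 < B ->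
  (forall S, measurable S -> (A%:E * mu S <= leb01 S)%E) ->
  (forall S, measurable S -> (leb01 S <= B%:E * mu S)%E) ->
  mu `<< leb /\ {ae leb, forall x, `[0%R, 1%R[%classic x ->
    (B^-1%:E <= ('d (charge_of_finite_measure mu) '/d leb) x
     /\ ('d (charge_of_finite_measure mu) '/d leb) x <= A^-1%:E)%E}.
Proof.
move=> A0 B0 lb ub.
have mul : mu `<< leb.
  apply/null_content_dominatesP => S mS S0; apply/eqP; rewrite -measure_le0.
  have l0 : leb01 S = 0%E by apply: (subset_measure0 _ mS _ S0) => //; exact: measurableI.
  by have := lb S mS; rewrite l0 pmule_rle0// lte_fin.
split => //; set W := Radon_Nikodym _ _.
have Wfin x : W x \is a fin_num by exact: Radon_Nikodym_fin_num.
have iW : leb.-integrable setT W by exact: Radon_Nikodym_integrable.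
have mW : measurable_fun setT W by exact: measurable_int iW.
have WE S : measurable S -> mu S = (\int[leb]_(x in S) W x)%E.
  move=> mS.
  exact: (@Radon_Nikodym_integral _ _ _ (charge_of_finite_measure mu) _ S mul mS).
have lebS (S : set T) : measurable S -> S `<=` `[0%R, 1%R[ -> leb01 S = leb S.
  by move=> mS S01; rewrite /leb01/= /mfrestr /mrestr setIidl.
have muS_fin (S : set T) : measurable S -> mu S \is a fin_num by move=> mS; exact: fin_num_measure.
have lebS_fin (S : set T) : measurable S -> S `<=` `[0%R, 1%R[ -> leb S \is a fin_num.
  by move=> mS S01; rewrite -lebS// fin_num_measure.
have iS (S : set T) : measurable S -> leb.-integrable S W by move=> mS; exact: integrableS iW.
have icst (S : set T) (c : R) : measurable S -> S `<=` `[0%R, 1%R[ -> leb.-integrable S (cst c%:E).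
  move=> mS S01; apply/integrableP; split; first exact: measurable_cst.
  by rewrite integral_cst//= -ge0_fin_numE ?mule_ge0// fin_numM// lebS_fin.
have icstE (S : set T) (c : R) : measurable S -> S `<=` `[0%R, 1%R[ ->
    (\int[leb]_(x in S) c%:E = (c * fine (leb S))%:E)%E.
  by move=> mS S01; rewrite integral_cst// EFinM fineK// lebS_fin.
(* On [E1] the function [B^-1 - W] is positive, yet its integral [B^-1 * leb E1 - mu E1] is at most
   0 by [ub]; hence [E1] is null. The same holds for [E2], with [W - A^-1] and [lb]. *)
pose E1 := `[0%R, 1%R[%classic `&` [set x | W x < B^-1%:E]%E.
pose E2 := `[0%R, 1%R[%classic `&` [set x | A^-1%:E < W x]%E.
have mE1 : measurable (E1 : set T).
  by apply: emeasurable_fun_infty_o; [exact: measurable_unit_itv|exact: measurable_funTS].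
have mE2 : measurable (E2 : set T).
  by apply: emeasurable_fun_o_infty; [exact: measurable_unit_itv|exact: measurable_funTS].
have E10 : leb E1 = 0%E.
  have E1s : E1 `<=` `[0%R, 1%R[ by move=> x [].
  apply: (@measure0_integral_le0 _ _ (fun x => B^-1%:E - W x)%E) => //.
  - by apply: emeasurable_funB; [exact: measurable_cst|exact: measurable_funTS].
  - by move=> t [_ /= h]; rewrite sube_gt0.
  rewrite integralB//; [|exact: icst|exact: iS].
  rewrite -WE// icstE//; have := ub _ mE1; rewrite lebS//.
  rewrite -(fineK (muS_fin _ mE1)) -{1}(fineK (lebS_fin _ mE1 E1s)) -EFinM -EFinB !lee_fin.
  by rewrite subr_le0 ler_pdivrMl.
have E20 : leb E2 = 0%E.
  have E2s : E2 `<=` `[0%R, 1%R[ by move=> x [].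
  apply: (@measure0_integral_le0 _ _ (fun x => W x - A^-1%:E)%E) => //.
  - by apply: emeasurable_funB; [exact: measurable_funTS|exact: measurable_cst].
  - by move=> t [_ /=]; rewrite -(fineK (Wfin t)) -!EFinD !lte_fin subr_gt0.
  rewrite integralB//; [|exact: iS|exact: icst].
  rewrite -WE// icstE//; have := lb _ mE2; rewrite lebS//.
  rewrite -(fineK (muS_fin _ mE2)) -{1}(fineK (lebS_fin _ mE2 E2s)) -EFinM -EFinB !lee_fin.
  by rewrite subr_le0 ler_pdivlMl.
exists (E1 `|` E2); split; first exact: measurableU.
  apply/eqP; rewrite -measure_le0; apply: (le_trans (measureU2 _ mE1 mE2)).
  by rewrite [X in (X + _)%E]E10 [X in (_ + X)%E]E20 adde0.
move=> x /= /not_implyP[x01 /not_andP[|] /negP]; rewrite -ltNge => h; [left|right]; by split.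
Qed.

End radon_nikodym_density.

Section measure_add_finite.
Context d (T : measurableType d) (R : realType).
Variables m1 m2 : {finite_measure set T -> \bar R}.

Let measure_add_fin : fin_num_fun (measure_add m1 m2).
Proof. by move=> A mA; rewrite measure_addE fin_numD !fin_num_measure. Qed.

HB.instance Definition _ := Measure.on (measure_add m1 m2).
HB.instance Definition _ := Measure_isFinite.Build _ _ _ (measure_add m1 m2) measure_add_fin.

End measure_add_finite.

Section comparison.
Variable R : realType.
Local Notation T := (measurableTypeR R).

Lemma energy_indicator (mu : {measure set T -> \bar R}) (S : set T) : measurable S ->
  energy mu (fun t => (\1_S t)%:C) = mu S.
Proof.
move=> mS; transitivity (\int[mu]_t (\1_S t)%:E)%E; last by rewrite integral_indic// setIT.
apply: eq_integral => t _; rewrite sq_modE/= [0 ^+ 2]expr0n/= addr0 indicE.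
by case: (t \in S); rewrite ?expr1n ?expr0n.
Qed.

Lemma sq_norm_perturbation (V : lmodType R[i]) (H : set V) (ip : V -> V -> R[i])
    (x y : V) (eps : R) : pre_hilbert H ip -> H x -> H y -> 0 < eps ->
  sq_norm ip (x - y) <= eps ^+ 2 ->
  `|sq_norm ip y - sq_norm ip x| <= eps ^+ 2 + eps * (sq_norm ip x + 1).
Proof.
move=> HV Hx Hy eps0 xy; have Hxy := pre_hilbertB HV Hx Hy.
have Nx := sq_norm_ge0 HV Hx; have Nxy := sq_norm_ge0 HV Hxy.
have -> : sq_norm ip y = sq_norm ip x + sq_norm ip (x - y) - complex.Re (ip x (x - y)) *+ 2.
  by rewrite -(sq_normB HV)// opprB addrC subrK.
have cs : sq_mod (ip x (x - y)) <= sq_norm ip x * eps ^+ 2.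
  by apply: (le_trans (cauchy_schwarz HV Hx Hxy)); rewrite ler_wpM2l.
have : `|complex.Re (ip x (x - y)) *+ 2| <= eps * (sq_norm ip x + 1).
  rewrite -ler_sqr ?nnegrE ?mulr_ge0 ?(ltW eps0) ?addr_ge0// real_normK ?num_real//.
  (* Cauchy-Schwarz with [4 n <= (n + 1)^2], that is [(n - 1)^2 >= 0], where [n] is the squared norm
     of [x]. The estimate thus stays linear in [n], free of square roots. *)
  move: cs; rewrite sq_modE; have := sqr_ge0 (complex.Im (ip x (x - y))).
  move: (complex.Re _) (complex.Im _ ^+ 2) (sq_norm ip x) Nx => a b n n0 b0 h.
  have : 0 <= eps ^+ 2 * (n - 1) ^+ 2 by rewrite mulr_ge0 ?sqr_ge0.
  nra.
rewrite !ler_norml => /andP[]; move: (complex.Re _ *+ 2) => r h1 h2; apply/andP; split; lra.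
Qed.

(** The measure of [S] is the squared norm of its indicator, so the inequality for polynomials
    passes to the limit once a single polynomial is close to the indicator for both measures. *)
Lemma trigpoly_comparison_measure (mu nu : {finite_measure set T -> \bar R}) (C : R) :
  mu (~` `[0%R, 1%R[) = 0%E -> nu (~` `[0%R, 1%R[) = 0%E -> 0 <= C ->
  (forall p, trigpoly p -> sq_norm (L2_ip mu) p <= C * sq_norm (L2_ip nu) p) ->
  forall S, measurable S -> (mu S <= C%:E * nu S)%E.
Proof.
move=> mu01 nu01 C0 le S mS.
pose om : {finite_measure set T -> \bar R} := measure_add mu nu.
have om01 : om (~` `[0%R, 1%R[) = 0%E.
  by rewrite -(adde0 0%E) -[X in (X + _)%E]mu01 -nu01; exact: measure_addE.
pose f t : R[i] := (\1_S t)%:C.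
have [mf fp] := approximable_indicator om01 mS.
have energy_om x : cmeasurable x -> energy om x = (energy mu x + energy nu x)%E.
  move=> mx; rewrite /energy ge0_integral_measure_add//; last exact: emeasurable_sq_mod.
  by move=> t _; rewrite lee_fin sq_mod_ge0.
have Lf (m : {finite_measure set T -> \bar R}) : L2 m f.
  by apply/L2P; split => //; rewrite energy_indicator// ltey_eq fin_num_measure.
have fE (m : {finite_measure set T -> \bar R}) : m S = (sq_norm (L2_ip m) f)%:E.
  by rewrite (L2_sq_normE (Lf m)) energy_indicator.
rewrite !fE -EFinM lee_fin; set a := sq_norm _ _; set b := sq_norm _ _.
have a0 : 0 <= a := sq_norm_ge0 (L2_pre_hilbert mu) (Lf mu).
have b0 : 0 <= b := sq_norm_ge0 (L2_pre_hilbert nu) (Lf nu).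
have K0 : 0 < a + 2 + C * (b + 2) + 1 by rewrite ltr_wpDl// addr_ge0 ?mulr_ge0 ?addr_ge0.
apply/ler_addgt0Pr => eps eps0.
(* Since [dl ^+ 2 <= dl], the two norms move by at most [dl (a + 2)] and [dl (b + 2)], the second
   multiplied by [C]. The final [+ 1] keeps the denominator positive. *)
pose dl := Num.min 1 (eps / (a + 2 + C * (b + 2) + 1)).
have dl0 : 0 < dl by rewrite lt_min ltr01 divr_gt0.
have dl1 : dl <= 1 by rewrite ge_min lexx.
have dlK : dl * (a + 2 + C * (b + 2) + 1) <= eps by rewrite -ler_pdivlMr// ge_min lexx orbT.
have [|p tp] := fp (dl ^+ 2); first by rewrite exprn_gt0.
have mp := cmeasurable_trigpoly tp; rewrite energy_om; last exact: cmeasurableB.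
move=> h.
have near (m : {finite_measure set T -> \bar R}) :
    (energy m (fun t => f t - p t)%R <= (dl ^+ 2)%:E)%E ->
    `|sq_norm (L2_ip m) p - sq_norm (L2_ip m) f| <= dl ^+ 2 + dl * (sq_norm (L2_ip m) f + 1).
  move=> hm; have HV := L2_pre_hilbert m; have Lp := L2_trigpoly m tp.
  apply: (sq_norm_perturbation HV) => //.
  by rewrite -lee_fin (L2_sq_normE (pre_hilbertB HV (Lf m) Lp)).
have /near : (energy mu (fun t => f t - p t)%R <= (dl ^+ 2)%:E)%E.
  by apply: le_trans h; rewrite leeDl// energy_ge0.
have /near : (energy nu (fun t => f t - p t)%R <= (dl ^+ 2)%:E)%E.
  by apply: le_trans h; rewrite leeDr// energy_ge0.
rewrite -/a -/b !ler_norml => /andP[_ hb] /andP[ha _].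
have := le _ tp; move: ha hb; move: (sq_norm _ p) (sq_norm _ p) => pn pm ha hb pC.
have d2 : dl ^+ 2 <= dl by rewrite expr2 ler_piMl// ltW.
have pnb : pn <= b + dl * (b + 2) by lra.
have : C * pn <= C * (b + dl * (b + 2)) by rewrite ler_wpM2l.
lra.
Qed.

End comparison.
Theorem theorem3p4 (R : realType)
    (mu : {finite_measure set (measurableTypeR R) -> \bar R})
    (mu01 : mu (~` `[0%R, 1%R[) = 0%E) :
  (exists g : int -> (measurableTypeR R -> R[i]),
     dextrodual (L2 mu) (L2_ip mu) g (@fourier_exp R) /\
     is_riesz_basis (L2 mu) (L2_ip mu) g)
  <->
  (mu `<< @lebesgue_measure R /\
   exists m M : R, [/\ 0 < m, m <= M &
     {ae @lebesgue_measure R, forall x, `[0%R, 1%R[%classic x ->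
       (m%:E <= ('d (charge_of_finite_measure mu) '/d (@lebesgue_measure R)) x
        /\ ('d (charge_of_finite_measure mu) '/d (@lebesgue_measure R)) x
           <= M%:E)%E}]).
Proof.
have HV := L2_pre_hilbert mu.
have HV1 := L2_pre_hilbert (leb01 : {measure set (measurableTypeR R) -> \bar R}).
split=> [[g [dual riesz]]|[mul [m [M [m0 mM bnd]]]]]; last first.
  have [F [mF mFM dens]] := radon_nikodym_bounded_density mu01 mul mM bnd.
  by exists (dual_exp F); exact: dual_exp_riesz_dextrodual mF m0 mFM dens.
have biorth := riesz_dextrodual_biorthogonal HV (@L2_complete _ _ _ mu) dual riesz.
have [/(is_frame_sqsum HV)[Lg [A [B [A0 B0 lb ub]]]] _] := riesz.
have normE p : trigpoly p ->
    sqsum (fun n => L2_ip mu p (g n)) = (sq_norm (L2_ip leb01) p)%:E.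
  move=> /trigpoly_psum[c [M0 /(_ _ (leqnn _))->]].
  rewrite (sqsum_biorthogonal_psum HV c M0 Lg (L2_fourier_exp mu) biorth).
  by rewrite (sq_norm_orthonormal_psum HV1 (L2_fourier_exp leb01) (@fourier_orthonormal R)).
have cmp1 p : trigpoly p -> sq_norm (L2_ip mu) p <= A^-1 * sq_norm (L2_ip leb01) p.
  by move=> tp; rewrite ler_pdivlMl// -lee_fin -normE//; apply: lb; exact: L2_trigpoly.
have cmp2 p : trigpoly p -> sq_norm (L2_ip leb01) p <= B * sq_norm (L2_ip mu) p.
  by move=> tp; rewrite -lee_fin -normE//; apply: ub; exact: L2_trigpoly.
have leb01C := @leb01_unit_itvC R.
have Ainv0 : 0 <= A^-1 by rewrite invr_ge0 ltW.
have le1 := trigpoly_comparison_measure mu01 leb01C Ainv0 cmp1.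
have le2 := trigpoly_comparison_measure leb01C mu01 (ltW B0) cmp2.
have [|mul bnd] := comparable_radon_nikodym A0 B0 _ le2.
  by move=> S /le1; rewrite lee_pdivlMl.
(* Enlarging the upper bound [A^-1] by [B^-1] gives [m <= M] at once, without comparing [A] and
   [B]. *)
split=> //; exists B^-1, (A^-1 + B^-1); split; rewrite ?invr_gt0 ?lerDr//.
apply: (@filterS _ _ (ae_filter_ringOfSetsType lebesgue_measure) _ _ _ bnd) => x bx x01.
have [bl bu] := bx x01; split => //; apply: (le_trans bu).
by rewrite lee_fin lerDl invr_ge0 ltW.
Qed.
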